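(* Let $T:X\to X$ be a homeomorphism of a compact metric space $(X,d)$ with the specification property, let $\tau:X\to(0,\infty)$ be a continuous roof function, and let $(X_\tau,\Theta)$ be the corresponding suspension flow. Let $\Phi,H\in C(X_\tau)$. Then for every $\alpha\in\mathbb{R}$ with $K(\Phi,\alpha)\ne\emptyset$, $$\sup_{(x,s)\in K(\Phi,\alpha)}\limsup_{t\to\infty}\frac1t\int_0^t H(\theta_u(x,s))\,du=\sup\Big\{\int H\,d\nu:\nu\in\mathcal{M}_\Theta,\ \int\Phi\,d\nu=\alpha\Big\}=\sup\Big\{\int H\,d\nu:\nu\in\bigcup_{(x,s)\in K(\Phi,\alpha)}\mathcal{V}((x,s))\Big\}.$$
   Context: $(X,T)$ has the specification property if for every $\epsilon>0$ there is an integer $m(\epsilon)$ such that for any finite collection of intervals $[a_j,b_j]\subset\mathbb{N}$, $j=1,\dots,k$, with $a_{j+1}-b_j\ge m(\epsilon)$ for $j=1,\dots,k-1$, and any $x_1,\dots,x_k\in X$, there is $x\in X$ with $d(T^{p+a_j}x,T^px_j)<\epsilon$ for all $p=0,\dots,b_j-a_j$ and all $j$. The suspension space is $X_\tau=\{(x,s)\in X\times\mathbb{R}:0\le s\le\tau(x)\}$ with $(x,\tau(x))$ identified with $(Tx,0)$, equipped with the Bowen–Walters metric (making it compact); the suspension flow is $\theta_t(x,s)=(x,s+t)$ (with the identification). $\mathcal{M}_\Theta$ is the set of Borel probability measures on $X_\tau$ invariant under all $\theta_t$, $t\ge0$. $K(\Phi,\alpha)=\{(x,s)\in X_\tau:\lim_{t\to\infty}\frac1t\int_0^t\Phi(\theta_u(x,s))\,du=\alpha\}$.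 For $(x,s)\in X_\tau$, $\mathcal{V}((x,s))$ is the set of weak$^*$ limit points as $t\to\infty$ of $\delta_{(x,s),t}=\frac1t\int_0^t\delta_{\theta_u(x,s)}\,du$. *)

(* Defs.v *)
From HB Require Import structures.
From mathcomp Require Import all_boot all_order all_algebra.
From mathcomp Require Import all_classical all_reals all_analysis.
Set Implicit Arguments. Unset Strict Implicit. Unset Printing Implicit Defensive.
Import Order.TTheory GRing.Theory Num.Theory.
Import numFieldNormedType.Exports.
Local Open Scope classical_set_scope.
Local Open Scope ring_scope.

Section Suspension.
Context {R : realType} {X : pseudoPMetricType R}.

Definition homeomorphism (T : X -> X) : Prop :=
  continuous T /\ exists2 Ti : X -> X, continuous Ti & cancel T Ti /\ cancel Ti T.

Definition specification (T : X -> X) : Prop :=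
  forall eps : R, 0 < eps -> exists m : nat,
    forall (k : nat) (a b : nat -> nat) (xs : nat -> X),
      (forall j, (j < k)%N -> (a j <= b j)%N) ->
      (forall j, (j.+1 < k)%N -> (b j + m <= a j.+1)%N) ->
      exists x : X, forall j, (j < k)%N -> forall p, (p <= b j - a j)%N ->
        ball (iter (p + a j) T x) eps (iter p T (xs j)).

Record roof := Roof { roof_fun :> X -> R ; roof_pos : forall x, 0 < roof_fun x }.

Variables (T : X -> X) (tau : roof).

(* The suspension space X_tau, represented by the fundamental domain
   {(x,s) : 0 <= s < tau x}; (x, tau x) is identified with (T x, 0). *)
Definition susp_dom (p : X * R) : bool := (0 <= p.2) && (p.2 < tau p.1).
Definition susp := {p : X * R | susp_dom p}.

Lemma susp_point_dom : susp_dom (point, 0).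
Proof. by rewrite /susp_dom /= lexx roof_pos. Qed.

HB.instance Definition _ := Choice.on susp.
HB.instance Definition _ := isPointed.Build susp (exist _ (point, 0) susp_point_dom).

Definition susp_red (p : X * R) : X * R :=
  if p.2 == tau p.1 then (T p.1, 0) else p.

(* Quotient topology on X_tau (the topology of the Bowen--Walters metric). *)
Definition susp_open (U : set susp) : Prop :=
  exists V : set (X * R), open V /\
    forall p : X * R, 0 <= p.2 <= tau p.1 ->
      (V p <-> exists2 q : susp, U q & sval q = susp_red p).

Definition susp_continuous (f : susp -> R) : Prop :=
  forall W : set R, open W -> susp_open (f @^-1` W).

Definition roof_sum (n : nat) (x : X) : R := \sum_(i < n) tau (iter i T x).

(* The suspension flow theta_t, for t >= 0. *)
Definition theta (t : R) (p : susp) : susp :=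
  let x := (sval p).1 in let s := (sval p).2 in
  let n := xget 0%N (fun n => roof_sum n x <= s + t < roof_sum n.+1 x) in
  insubd p (iter n T x, s + t - roof_sum n x).

Definition susp_borel := g_sigma_algebraType susp_open.

Definition flow_invariant (nu : probability susp_borel R) : Prop :=
  forall t : R, 0 <= t -> forall A : set susp_borel, measurable A ->
    nu ((theta t : susp_borel -> susp_borel) @^-1` A) = nu A.

Definition time_avg (f : susp -> R) (p : susp) (t : R) : R :=
  Rintegral (@lebesgue_measure R) `[0, t] (fun u => f (theta u p)) / t.

Definition Kset (Phi : susp -> R) (alpha : R) : set susp :=
  [set p | time_avg Phi p t @[t --> +oo] --> alpha].

(* V(p): weak* limit points of delta_{p,t} as t -> oo.  A basic weak*
   neighbourhood of nu is given by finitely many f_i in C(X_tau) and eps > 0,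
   and int f d(delta_{p,t}) = time_avg f p t. *)
Definition limit_measures (p : susp) : set (probability susp_borel R) :=
  [set nu : probability susp_borel R | forall (k : nat) (fs : nat -> susp -> R),
     (forall i, (i < k)%N -> susp_continuous (fs i)) ->
     forall eps : R, 0 < eps -> forall M : R, exists t : R, M <= t /\
       forall i, (i < k)%N ->
         (`| (time_avg (fs i) p t)%:E - \int[nu]_q (fs i q)%:E | < eps%:E)%E].

End Suspension.

Arguments susp_open {R X} T tau U.
Arguments susp_continuous {R X} T tau f.
Arguments theta {R X} T tau t p.
Arguments flow_invariant {R X} T tau nu.
Arguments time_avg {R X} T tau f p t.
Arguments Kset {R X} T tau Phi alpha _.
Arguments limit_measures {R X} T tau p _.

(* Main.v *)
(* Points to measures: along an ultrafilter refining t -> oo on which the averages of H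
   almost attain their limsup, the time averages of continuous functions converge to a
   positive normalized functional.  Compactness gives Dini's property, so the functional is
   the integral of a measure (Daniell), which is invariant and lies in V(p).

   Measures to points: let nu be invariant and Phi_1, Phi_2 be the two functions, normalized
   to have integral 0.  No linear combination of their orbit sums is everywhere large, so
   orbit pieces can be chosen greedily, each almost orthogonal to or against the accumulated
   sum in R^2; the sums then grow like the square root of the number of pieces.  Read as
   pieces of T-orbits, they are glued by the specification property in successive stages
   of increasing precision and length, and the stages accumulate at a point whose averages
   converge to the integrals of nu. *)
Require Import Defs.
From HB Require Import structures.
From mathcomp Require Import all_boot all_order all_algebra.
From mathcomp Require Import all_classical all_reals all_analysis.
From mathcomp Require Import measurable_realfun zify ring lra.
Import Order.TTheory GRing.Theory Num.Theory.
Import numFieldNormedType.Exports.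
Local Open Scope classical_set_scope.
Local Open Scope ring_scope.
Set Implicit Arguments.
Unset Strict Implicit.
Unset Printing Implicit Defensive.


(** * Daniell extension of a positive functional *)

(** Specification concerns iterates of [T]: a shadowing point has other roof sums than the points it
    shadows, so flow times drift along a glued orbit. Normalizing both integrals to 0 removes this
    obstacle. It is then enough that the integrals over n consecutive fibres are o(n), and since the
    roof lies between two positive constants, o(n) fibres means o(t) in flow time; flow times are
    never matched. [Phi] and [H] are treated together because their averages must converge along the
    same orbit.

    The measure need not be ergodic, so the ergodic theorem does not directly supply a typical
    point. The greedy choice uses only that orbit sums have integral 0 by invariance, and that a
    function with integral 0 is at most 1 somewhere.

    In the other direction an ultrafilter gives the limits of the averages of all continuous
    functions at once. Measure theory on the quotient rests on one topological fact: every open set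
    is the set where some continuous function is positive. *)

Section Daniell.
Variables (R : realType) (Y : pointedType) (C : set (Y -> R)) (L : (Y -> R) -> R).
Hypothesis Ccst : forall c, C (fun=> c).
Hypothesis CD : forall f g, C f -> C g -> C (fun y => f y + g y).
Hypothesis CM : forall f g, C f -> C g -> C (fun y => f y * g y).
Hypothesis Cmax : forall f g, C f -> C g -> C (fun y => Num.max (f y) (g y)).
Hypothesis LD : forall f g, C f -> C g -> L (fun y => f y + g y) = L f + L g.
Hypothesis LZ : forall c f, C f -> L (fun y => c * f y) = c * L f.
Hypothesis Lle : forall f g, C f -> C g -> (forall y, f y <= g y) -> L f <= L g.
Hypothesis L1 : L (fun=> 1) = 1.

(* [A] is covered by the nondecreasing sequence [g] when [sup_n g n >= 1] on [A]. *)
Definition dcover (A : set Y) : set (nat -> Y -> R) :=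
  [set g | [/\ forall n, C (g n), forall n y, 0 <= g n y,
    forall n y, g n y <= g n.+1 y &
    forall y, A y -> forall c, c < 1 -> exists n, c < g n y]].

Hypothesis dini : forall g, dcover setT g ->
  forall c, c < 1 -> exists n, forall y, c <= g n y.

Definition dvalue (g : nat -> Y -> R) : \bar R :=
  ereal_sup (range (fun n => (L (g n))%:E)).

Definition douter (A : set Y) : \bar R := ereal_inf (dvalue @` dcover A).

Let CN f : C f -> C (fun y => - f y).
Proof.
move=> Cf; have := CM (Ccst (-1)) Cf; congr C.
by apply/funext => y; rewrite mulN1r.
Qed.

Let Cmin f g : C f -> C g -> C (fun y => Num.min (f y) (g y)).
Proof.
move=> Cf Cg; have := CN (Cmax (CN Cf) (CN Cg)); congr C.
by apply/funext => y; rewrite oppr_max !opprK.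
Qed.

Let CZ c f : C f -> C (fun y => c * f y).
Proof. by move=> Cf; exact: CM (Ccst c) Cf. Qed.

Let Lc c : L (fun=> c) = c.
Proof.
transitivity (L (fun=> c * 1)); first by rewrite mulr1.
by rewrite LZ ?L1 ?mulr1.
Qed.

Let L_ge0 f : C f -> (forall y, 0 <= f y) -> 0 <= L f.
Proof. by move=> Cf f0; rewrite -[leLHS](Lc 0); exact: Lle. Qed.

Lemma dcover_homo A g : dcover A g ->
  forall y, {homo (fun n => g n y) : m n / (m <= n)%N >-> m <= n}.
Proof. by case=> _ _ gm _ y; apply: homo_leq => //; exact: le_trans. Qed.

Lemma dvalue_ge0 A g : dcover A g -> (0 <= dvalue g)%E.
Proof.
move=> [gC g0 _ _]; apply: le_trans (ereal_sup_ubound (imageT _ 0%N)).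
by rewrite lee_fin L_ge0.
Qed.

Lemma douter_ge0 A : (0 <= douter A)%E.
Proof. by apply: le_ereal_inf_tmp => _ [g gA <-]; exact: dvalue_ge0 gA. Qed.

Lemma douter_le A g : dcover A g -> (douter A <= dvalue g)%E.
Proof. by move=> gA; apply: ereal_inf_lbound; exists g. Qed.

Lemma le_douter A B : A `<=` B -> (douter A <= douter B)%E.
Proof.
move=> AB; apply: le_ereal_inf_tmp => _ [g gB <-]; apply: douter_le.
by case: gB => *; split => // y /AB; auto.
Qed.

Lemma dcover_cst A f : C f -> (forall y, 0 <= f y) -> (forall y, A y -> 1 <= f y) ->
  (douter A <= (L f)%:E)%E.
Proof.
move=> Cf f0 f1; apply: le_trans (douter_le (g := fun=> f) _) _.
  by split => // y Ay c c1; exists 0%N; exact: lt_le_trans c1 (f1 _ Ay).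
by apply: ge_ereal_sup => _ [n _ <-].
Qed.

Lemma douter0 : douter set0 = 0%E.
Proof.
apply/eqP; rewrite eq_le douter_ge0 andbT -[X in (_ <= X%:E)%E](Lc 0).
exact: dcover_cst.
Qed.

(** The lower bound is the one place where Dini's property enters: a cover of the whole space is
    eventually at least 1 - e uniformly, so positivity of [L] applies. Total mass 1 is what later
    lets [daniell] turn a one-sided estimate into an equality. *)
Lemma douterT : douter setT = 1%E.
Proof.
apply/eqP; rewrite eq_le; apply/andP; split.
  by rewrite -[X in (_ <= X%:E)%E]L1; apply: dcover_cst => // y; exact: ler01.
apply: le_ereal_inf_tmp => _ [g gT <-]; apply/lee_subgt0Pr => e e0.
have [|n gn] := dini gT (c := 1 - e); first by lra.
apply: le_trans (ereal_sup_ubound (imageT _ n)).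
rewrite -EFinB lee_fin -(Lc (1 - e)); apply: Lle => //.
by case: gT.
Qed.

Let CS (F : nat -> Y -> R) n : (forall k, C (F k)) -> C (fun y => \sum_(k < n) F k y).
Proof.
move=> CF; elim: n => [|n IH].
  by have := Ccst 0; congr C; apply/funext => y; rewrite big_ord0.
by have := CD IH (CF n); congr C; apply/funext => y; rewrite big_ord_recr.
Qed.

Let LS (F : nat -> Y -> R) n : (forall k, C (F k)) ->
  L (fun y => \sum_(k < n) F k y) = \sum_(k < n) L (F k).
Proof.
move=> CF; elim: n => [|n IH].
  by rewrite big_ord0 -[RHS](Lc 0); congr L; apply/funext => y; rewrite big_ord0.
rewrite big_ord_recr/= -IH -LD//; last exact: CS.
by congr L; apply/funext => y; rewrite big_ord_recr.
Qed.

Lemma douter_sigma_subadditive : sigma_subadditive douter.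
Proof.
move=> A.
have [[k Ak]|fin] := pselect (exists k, douter (A k) = +oo%E).
  rewrite (@eseries_pinfty _ _ xpredT k) ?leey// => n _.
  by rewrite gt_eqF// (lt_le_trans _ (douter_ge0 _)).
apply/lee_addgt0Pr => e e0.
have h k : {g | dcover (A k) g & (dvalue g <= douter (A k) + (e / (2 ^+ k.+1))%:E)%E}.
  apply/cid2; have dk : douter (A k) \is a fin_num.
    by rewrite ge0_fin_numE ?douter_ge0// ltey; apply/eqP => ?; apply: fin; exists k.
  have e2 : 0 < e / 2 ^+ k.+1 by rewrite divr_gt0// exprn_gt0.
  have [_ [g gA <-] gl] := lb_ereal_inf_adherent e2 dk.
  by exists g => //; exact: ltW.
pose G k := s2val (h k).
have GA k : dcover (A k) (G k) by exact: s2valP.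
have Gd k : (dvalue (G k) <= douter (A k) + (e / 2 ^+ k.+1)%:E)%E by exact: (s2valP' (h k)).
have GC k n : C (G k n) by case: (GA k).
have G0 k n y : 0 <= G k n y by case: (GA k).
(* Diagonal choice: the number of summands and the index of each one grow together, so [H] is a
   single nondecreasing sequence that still covers the union. *)
pose H n y := \sum_(k < n) G k n y.
have HA : dcover (\bigcup_k A k) H.
  split => [n|n y|n y|y [k _ Aky] c c1].
  - exact: (CS (F := fun k => G k n)).

  - exact: sumr_ge0.
  - rewrite /H big_ord_recr/= -[leLHS]addr0; apply: lerD => //.
    by apply: ler_sum => k _; case: (GA k).
  - have [_ _ _ /(_ y Aky c c1)[n cn]] := GA k.
    exists (n + k.+1)%N; apply: (lt_le_trans cn).
    apply: (@le_trans _ _ (G k (n + k.+1)%N y)).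
      exact: (dcover_homo (GA k)) (leq_addr _ _).
    have kn : (k < n + k.+1)%N by rewrite addnS ltnS leq_addl.
    by rewrite /H (bigD1 (Ordinal kn))//= lerDl sumr_ge0.
apply: (le_trans (douter_le HA)); apply: ge_ereal_sup => _ [n _ <-].
rewrite /H (LS (F := fun k => G k n))// -sumEFin.
have := @epsilon_trick R (fun k => douter (A k)) e xpredT (fun k => douter_ge0 _) (ltW e0).
apply: le_trans.
apply: (@le_trans _ _ (\sum_(0 <= k < n) (douter (A k) + (e / (2 ^ k.+1)%:R)%:E))%E).
  rewrite big_mkord; apply: lee_sum => k _; rewrite natrX; apply: le_trans (Gd k).
  exact: (ereal_sup_ubound (imageT _ n)).
apply: nneseries_lim_ge => k _ _.
by rewrite adde_ge0// ?douter_ge0// lee_fin divr_ge0// ltW.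
Qed.

HB.instance Definition _ := isOuterMeasure.Build R Y douter douter0 douter_ge0
  (fun A B => @le_douter A B) douter_sigma_subadditive.

Let k_ (h : Y -> R) (n : nat) (y : Y) : R := Num.min 1 (n%:R * Num.max (h y) 0).

(* With k_n = min(1, n h^+) increasing to the indicator of [0 < h], a cover g of A splits
   into the cover g_n k_n of A `&` [0 < h] and, for each m, the cover g_n (1 - k_m) of
   A `\` [0 < h]. *)
Lemma caratheodory_pos h : C h -> douter.-caratheodory [set y | 0 < h y].
Proof.
move=> Ch; apply: le_caratheodory_measurable => A.
apply: le_ereal_inf_tmp => _ [g gA <-].
have [->|fin] := eqVneq (dvalue g) +oo%E; first by rewrite leey.
have vf : dvalue g \is a fin_num by rewrite ge0_fin_numE ?ltey// (dvalue_ge0 gA).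
have kC n : C (k_ h n) by apply/Cmin => //; apply: CZ; exact: Cmax.
have k0 n y : 0 <= k_ h n y.
  by rewrite /k_ le_min ler01/= mulr_ge0// le_max lexx orbT.
have k1 n y : k_ h n y <= 1 by rewrite /k_ ge_min lexx.
have kS m n y : (m <= n)%N -> k_ h m y <= k_ h n y.
  move=> mn; rewrite /k_ le_min ge_min lexx/= ge_min; apply/orP; right.
  by apply: ler_wpM2r; rewrite ?ler_nat// le_max lexx orbT.
have [gC g0 gS gc] := gA.
have cU : dcover (A `&` [set y | 0 < h y]) (fun n y => g n y * k_ h n y).
  split => [n|n y|n y|y [Ay hy] c c1]; first exact: CM.
  - exact: mulr_ge0.
  - by apply: ler_pM => //; exact: kS.
  - have [n cn] := gc y Ay c c1.
    have [m hm] : exists m : nat, 1 <= m%:R * h y.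
      exists (Num.truncn (h y)^-1).+1; rewrite -ler_pdivrMr// mul1r.
      exact/ltW/truncnS_gt.
    exists (n + m)%N; have -> : k_ h (n + m) y = 1.
      apply/eqP; rewrite eq_le k1/= /k_ le_min lexx/= (max_idPl (ltW hy)).
      by apply: le_trans hm _; rewrite ler_pM2r// ler_nat leq_addl.
    by rewrite mulr1 (lt_le_trans cn)// (dcover_homo gA)// leq_addr.
have cN m : dcover (A `\` [set y | 0 < h y]) (fun n y => g n y * (1 - k_ h m y)).
  have C1 : C (fun y => 1 - k_ h m y) by apply: CD => //; exact: CN.
  split => [n|n y|n y|y [Ay hy] c c1]; first exact: CM.
  - by rewrite mulr_ge0// subr_ge0.
  - by rewrite ler_wpM2r// subr_ge0.
  - have [n cn] := gc y Ay c c1; exists n.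
    rewrite /k_ (max_idPr _) ?mulr0 ?(min_idPr ler01) ?subr0 ?mulr1//.
    by rewrite leNgt; apply/negP.
set vU := dvalue (fun n y => g n y * k_ h n y).
have vUg : (vU <= dvalue g)%E.
  apply: ge_ereal_sup => _ [n _ <-].
  apply: le_trans (ereal_sup_ubound (imageT _ n)).
  rewrite lee_fin; apply: Lle => //; first exact: CM.
  by move=> y; rewrite ler_piMr.
have vUf : vU \is a fin_num.
  by rewrite ge0_fin_numE ?(dvalue_ge0 cU)// (le_lt_trans vUg)// ltey.
apply/lee_addgt0Pr => e e0.
have [_ [m _ <-] Hm] := ub_ereal_sup_adherent e0 vUf.
set vN := dvalue (fun n y => g n y * (1 - k_ h m y)).
apply: (@le_trans _ _ (vU + vN)%E).
  by apply: leeD; exact: douter_le.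
rewrite addeC -leeBrDr//; apply: ge_ereal_sup => _ [n _ <-].
apply: (@le_trans _ _ (L (g (n + m)%N) - L (fun y => g m y * k_ h m y))%:E).
  rewrite lee_fin lerBrDr -LD; [|exact: CM (gC _) (CD (Ccst 1) (CN (kC _)))|exact: CM].
  apply: Lle => // [|y].
    by apply: CD; [exact: CM (gC _) (CD (Ccst 1) (CN (kC _)))|exact: CM].
  rewrite mulrBr mulr1.
  have a1 := k1 m y. have a0 := k0 m y.
  have b1 : g n y <= g (n + m)%N y by rewrite (dcover_homo gA)// leq_addr.
  have b2 : g m y <= g (n + m)%N y by rewrite (dcover_homo gA)// leq_addl.
  by nra.
rewrite EFinB; move: Hm; set lm := L (fun y => g m y * k_ h m y) => Hm.
apply: (@le_trans _ _ (dvalue g - lm%:E)%E).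
  by apply: leeB => //; exact: (ereal_sup_ubound (imageT _ _)).
have {Hm}: (vU - e%:E < lm%:E)%E by [].
rewrite -(fineK vUf) -(fineK vf) -!(EFinB, EFinD) lte_fin lee_fin.
lra.
Qed.

Variable G : set (set Y).
Hypothesis GC : forall U, G U -> exists2 h, C h & U = [set y | 0 < h y].
Hypothesis Cmeas : forall f, C f ->
  measurable_fun [set: g_sigma_algebraType G] (f : g_sigma_algebraType G -> R).

Lemma sigma_caratheodory (A : set (g_sigma_algebraType G)) :
  measurable A -> douter.-caratheodory A.
Proof.
apply: smallest_sub => [|U /GC[h Ch ->]]; last exact: caratheodory_pos.
by split=> [|B cB|F cF]; [exact: caratheodory_measurable_set0|
  rewrite setTD; exact: caratheodory_measurable_setC|
  exact: caratheodory_measurable_bigcup].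
Qed.

Definition dmeasure (A : set (g_sigma_algebraType G)) : \bar R := douter A.

Let dmeasure0 : dmeasure set0 = 0%E. Proof. exact: douter0. Qed.
Let dmeasure_ge0 A : (0 <= dmeasure A)%E. Proof. exact: douter_ge0. Qed.
Let dmeasure_sigma : semi_sigma_additive dmeasure.
Proof.
move=> F mF tF mUF.
by apply: (@caratheodory_measure_sigma_additive R Y douter) => // [n|];
  exact: sigma_caratheodory.
Qed.
HB.instance Definition _ := isMeasure.Build _ _ _ dmeasure
  dmeasure0 dmeasure_ge0 dmeasure_sigma.
Let dmeasureT : dmeasure setT = 1%E. Proof. exact: douterT. Qed.
HB.instance Definition _ := Measure_isProbability.Build _ _ _ dmeasure dmeasureT.

Hypothesis Cbnd : forall f, C f -> exists M : R, forall y, `|f y| <= M.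

Let nu : probability (g_sigma_algebraType G) R := dmeasure.

Let Cint f : C f -> nu.-integrable setT (EFin \o (f : g_sigma_algebraType G -> R)).
Proof.
move=> Cf; apply: measurable_bounded_integrable => //.
- by rewrite (le_lt_trans (probability_le1 _ _))// ltry.
- exact: Cmeas.
- have [M fM] := Cbnd Cf; exists M; split; first exact: num_real.
  by move=> x Mx y _; exact: le_trans (fM y) (ltW Mx).
Qed.

Let Cint_emeas f : C f ->
  measurable_fun [set: g_sigma_algebraType G] (fun y : g_sigma_algebraType G => (f y)%:E : \bar R).
Proof. by move=> Cf; apply/measurable_EFinP; exact: Cmeas. Qed.

(* Layer cake: f is cut into the slices c_n = min(f, (n+1)e) - min(f, ne), and
   c_{n+1} <= e 1_[f > (n+1)e] <= c_n. *)
Lemma dmeasure_le f e : C f -> (forall y, 0 <= f y) -> 0 < e ->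
  (\int[nu]_y (f y)%:E <= (e + L f)%:E)%E.
Proof.
move=> Cf f0 e0; have [M fM] := Cbnd Cf.
pose m n y := Num.min (f y) (n%:R * e).
have mC n : C (m n) by exact: Cmin.
have m0 n y : 0 <= m n y by rewrite le_min f0/= mulr_ge0// ltW.
pose c n y := m n.+1 y - m n y.
have cC n : C (c n) by apply: CD => //; exact: CN.
have nS n : n.+1%:R * e = n%:R * e + e by rewrite -natr1 mulrDl mul1r.
have c0 n y : 0 <= c n y.
  by rewrite subr_ge0 /m nS le_min !ge_min lexx/= lerDl (ltW e0) orbT.
have step n : (\int[nu]_y (c n.+1 y)%:E <= (L (c n))%:E)%E.
  pose U : set (g_sigma_algebraType G) := [set y | n.+1%:R * e < f y].
  have mU : measurable U.
    have := Cmeas Cf measurableT (measurable_itv `]n.+1%:R * e, +oo[).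
    rewrite setTI; congr measurable.
    by apply/seteqP; split=> y /=; rewrite in_itv/= andbT.
  have UL : (nu U <= (L (fun y => e^-1 * c n y))%:E)%E.
    apply: dcover_cst; first exact: CZ.
      by move=> y; rewrite mulr_ge0// invr_ge0 ltW.
    move=> y Uy; rewrite /c /m -ler_pdivrMl ?invr_gt0// invrK mulr1.
    have : n.+1%:R * e < f y by exact: Uy.
    rewrite nS => ef; rewrite !(min_idPr _); lra.
  apply: (@le_trans _ _ (e%:E * nu U)%E).
    rewrite -(setIT U) -integral_indic// -ge0_integralZl//; first last.
    - by rewrite lee_fin ltW.
    - exact/measurable_EFinP.
    apply: ge0_le_integral => //.
    - by move=> y _; rewrite lee_fin.
    - exact: Cint_emeas.
    - by apply: emeasurable_funM => //; exact/measurable_EFinP.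
    move=> y _; rewrite -EFinM lee_fin indicE.
    have [/set_mem Uy|] := boolP (y \in U).
      rewrite mulr1 /c /m (nS n.+1) lerBlDr; case: (leP (f y) (n.+1%:R * e)); last first.
        by move=> _; rewrite ge_min addrC lexx orbT.
      by move=> _; rewrite ge_min lerDr (ltW e0).
    move=> /negP Uy; rewrite mulr0 /c /m.
    have : f y <= n.+1%:R * e by rewrite leNgt; apply/negP => h; apply: Uy; exact/mem_set.
    by rewrite (nS n.+1) => h; rewrite !(min_idPl _) ?subrr//; lra.
  rewrite LZ// in UL; apply: (@le_trans _ _ (e%:E * (e^-1 * L (c n))%:E)%E).
    by rewrite lee_pmul2l.
  by rewrite -EFinM mulrA divff ?mul1r// gt_eqF.
(* The slices are compared with a shift of one; only the lowest, of height at most e on a space of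
   mass 1, is left over and gives the error e. *)
have main n : (\int[nu]_y (m n.+1 y)%:E <= (e + L (m n))%:E)%E.
  elim: n => [|n IH].
    apply: (@le_trans _ _ (\int[nu]_y (e%:E))%E).
      apply: ge0_le_integral => //.
      - by move=> y _; rewrite lee_fin.
      - exact: Cint_emeas.
      - by move=> y _; rewrite lee_fin /m mul1r ge_min lexx orbT.
    rewrite integral_cst// [X in (_ * X)%E]probability_setT mule1 lee_fin.
    by rewrite lerDl L_ge0.
  have -> : (\int[nu]_y (m n.+2 y)%:E =
             \int[nu]_y ((m n.+1 y)%:E + (c n.+1 y)%:E))%E.
    by apply: eq_integral => y _; rewrite -EFinD /c addrC subrK.
  rewrite ge0_integralD//; first last.
  - exact: Cint_emeas.
  - by move=> y _; rewrite lee_fin.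
  - exact: Cint_emeas.
  - by move=> y _; rewrite lee_fin.
  have -> : L (m n.+1) = L (m n) + L (c n).
    rewrite -LD//; congr L; apply/funext => y.
    by rewrite /c addrC subrK.
  by apply: le_trans (leeD IH (step n)) _; rewrite -EFinD lee_fin addrA.
have [n Mn] : exists n : nat, M <= n.+1%:R * e.
  exists (Num.truncn (M / e)); rewrite -ler_pdivrMr//.
  exact/ltW/truncnS_gt.
have -> : (\int[nu]_y (f y)%:E = \int[nu]_y (m n.+1 y)%:E)%E.
  apply: eq_integral => y _; congr EFin; rewrite /m (min_idPl _)//.
  by apply: le_trans Mn; apply: le_trans (fM y); exact: ler_norm.
apply: le_trans (main n) _; rewrite lee_fin lerD2l; apply: Lle => // y.
by rewrite ge_min lexx.
Qed.

(** Only an upper bound for nonnegative functions is known from [dmeasure_le]. Adding a constant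
    removes the sign condition, and applying the bound to -f reverses it. *)
Theorem daniell : exists nu : probability (g_sigma_algebraType G) R,
  forall f, C f -> (\int[nu]_y (f y)%:E = (L f)%:E)%E.
Proof.
exists nu => f Cf.
have le g : C g -> (forall y, 0 <= g y) -> (\int[nu]_y (g y)%:E <= (L g)%:E)%E.
  by move=> Cg g0; apply/lee_addgt0Pr => e e0; rewrite -EFinD addrC; exact: dmeasure_le.
have {}le g : C g -> (\int[nu]_y (g y)%:E <= (L g)%:E)%E.
  move=> Cg; have [M gM] := Cbnd Cg.
  have Mg y : 0 <= M + g y by have := gM y; rewrite ler_norml; lra.
  have := le _ (CD (Ccst M) Cg) Mg; rewrite LD// Lc.
  under eq_integral do rewrite EFinD.
  rewrite integralD//; [|exact: (Cint (Ccst M))|exact: Cint].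
  rewrite integral_cst// [X in (_ * X)%E]probability_setT mule1 EFinD.
  by rewrite leeD2lE.
apply/eqP; rewrite eq_le le//=.
have := le _ (CN Cf).
have -> : L (fun y => - f y) = - L f.
  by rewrite -mulN1r -LZ//; congr L; apply/funext => y; rewrite mulN1r.
under eq_integral do rewrite -mulN1r EFinM.
rewrite integralZl//; last exact: Cint.
by rewrite mulN1e EFinN leeN2.
Qed.

End Daniell.

(** * Boundedness on compact sets and continuity on products *)

Lemma compact_norm_bound {R : realType} {U : topologicalType} (K : set U) (f : U -> R) :
  compact K -> continuous f -> exists M : R, 0 <= M /\ forall y, K y -> `|f y| <= M.
Proof.
move=> cK cf; have : compact (f @` K).
  by apply: continuous_compact cK; exact: continuous_subspaceT.
move=> /compact_bounded[M [_ fM]]; exists (Num.max (M + 1) 0).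
split=> [|y Ky]; first by rewrite le_max lexx orbT.
by rewrite le_max; apply/orP; left; apply: (fM (M + 1)); [rewrite ltrDl|exists y].
Qed.

Section Continuity.
Context {U V W : topologicalType} {R : realType}.

Lemma cont_pair (f : U -> V) (g : U -> W) :
  continuous f -> continuous g -> continuous (fun x => (f x, g x)).
Proof. by move=> cf cg x; exact: (cvg_pair (cf x) (cg x)). Qed.

Lemma cont_comp (f : U -> V) (g : V -> W) :
  continuous f -> continuous g -> continuous (fun x => g (f x)).
Proof. by move=> cf cg x; apply: continuous_comp; [exact: cf|exact: cg]. Qed.

Lemma cont_fst : continuous (fst : U * V -> U).
Proof. by move=> x; exact: cvg_fst. Qed.

Lemma cont_snd : continuous (snd : U * V -> V).
Proof. by move=> x; exact: cvg_snd. Qed.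

Lemma cont_cst (v : V) : continuous (fun _ : U => v).
Proof. by move=> x; exact: cvg_cst. Qed.

Implicit Types f g : U -> R.

Lemma cont_add f g : continuous f -> continuous g -> continuous (fun x => f x + g x).
Proof. by move=> cf cg x; apply: cvgD; [exact: cf|exact: cg]. Qed.

Lemma cont_sub f g : continuous f -> continuous g -> continuous (fun x => f x - g x).
Proof. by move=> cf cg x; apply: cvgB; [exact: cf|exact: cg]. Qed.

Lemma cont_mul f g : continuous f -> continuous g -> continuous (fun x => f x * g x).
Proof. by move=> cf cg x; apply: cvgM; [exact: cf|exact: cg]. Qed.

Lemma cont_min f g : continuous f -> continuous g ->
  continuous (fun x => Num.min (f x) (g x)).
Proof. by move=> cf cg x; exact: (continuous_min (cf x) (cg x)). Qed.

Lemma cont_max f g : continuous f -> continuous g ->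
  continuous (fun x => Num.max (f x) (g x)).
Proof. by move=> cf cg x; exact: (continuous_max (cf x) (cg x)). Qed.
End Continuity.
Arguments cont_cst {U V} v.
Arguments cont_fst {U V}.
Arguments cont_snd {U V}.

(** * The suspension space and its continuous functions *)

Section RoofSums.
Context {R : realType} {X : pseudoPMetricType R}.
Variables (T : X -> X) (tau : @roof R X).
Hypothesis Tc : continuous T.
Hypothesis tauc : continuous (roof_fun tau).
Hypothesis cX : compact [set: X].

Local Notation S := (roof_sum T tau).

Lemma roof_bounds : exists a b : R, 0 < a /\ forall x, a <= tau x <= b.
Proof.
have [b [b0 Hb]] := compact_norm_bound cX tauc.
have ic : continuous (fun x => (tau x)^-1).
  by move=> x; apply: cvgV; [rewrite gt_eqF// roof_pos|exact: tauc].
have [a [a0 Ha]] := compact_norm_bound cX ic.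
have ap : 0 < a.
  by rewrite (lt_le_trans _ (Ha point I))// normr_gt0 invr_neq0// gt_eqF// roof_pos.
exists a^-1, b; rewrite invr_gt0; split => // x; apply/andP; split.
  rewrite -[leRHS]invrK lef_pV2 ?posrE ?invr_gt0 ?roof_pos//.
  exact: le_trans (ler_norm _) (Ha x I).
exact: le_trans (ler_norm _) (Hb x I).
Qed.

Lemma iter_cont n : continuous (iter n T).
Proof.
elim: n => [|n IH] x; first exact: cvg_id.
by rewrite /=; apply: continuous_comp; [exact: IH|exact: Tc].
Qed.

Lemma roof_sum0 x : S 0 x = 0.
Proof. by rewrite /roof_sum big_ord0. Qed.

Lemma roof_sumSr n x : S n.+1 x = S n x + tau (iter n T x).
Proof. by rewrite /roof_sum big_ord_recr. Qed.

Lemma roof_sumS n x : S n.+1 x = tau x + S n (T x).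
Proof.
rewrite /roof_sum big_ord_recl; congr (_ + _).
by apply: eq_bigr => i _; rewrite /= -iterSr.
Qed.

Lemma roof_sum_lt n x : S n x < S n.+1 x.
Proof. by rewrite roof_sumSr ltrDl roof_pos. Qed.

Lemma roof_sum_le m n x : (m <= n)%N -> S m x <= S n x.
Proof.
move=> /subnK <-; elim: (n - m)%N => [//|k IH].
by rewrite addSn; apply: le_trans IH (ltW (roof_sum_lt _ _)).
Qed.

Lemma roof_sum_ge0 n x : 0 <= S n x.
Proof. by rewrite -(roof_sum0 x); exact: roof_sum_le. Qed.

Lemma roof_sum_lower (a : R) n x : (forall y, a <= tau y) -> n%:R * a <= S n x.
Proof.
move=> aT; elim: n => [|n IH]; first by rewrite mul0r roof_sum0.
by rewrite roof_sumSr -natr1 mulrDl mul1r; exact: lerD.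
Qed.

Lemma roof_sum_upper (b : R) n x : (forall y, tau y <= b) -> S n x <= n%:R * b.
Proof.
move=> bT; elim: n => [|n IH]; first by rewrite mul0r roof_sum0.
by rewrite roof_sumSr -natr1 mulrDl mul1r; exact: lerD.
Qed.

Lemma roof_sum_cvg x (s : R) : exists n, s < S n x.
Proof.
have [a [b [a0 ab]]] := roof_bounds.
exists (Num.truncn (s / a)).+1; apply: lt_le_trans (@roof_sum_lower a _ _ _).
  by rewrite -ltr_pdivrMr// truncnS_gt.
by move=> y; case/andP: (ab y).
Qed.

Lemma roof_sum_ex x (s : R) : 0 <= s -> exists n, S n x <= s < S n.+1 x.
Proof.
move=> s0; have ex := roof_sum_cvg x s.
case: (ex_minnP ex) => -[|n] sn nmin; first by move: sn; rewrite roof_sum0 ltNge s0.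
exists n; rewrite sn andbT leNgt; apply/negP => /nmin.
by rewrite ltnn.
Qed.

Lemma roof_sum_uniq x (s : R) m n : S m x <= s < S m.+1 x -> S n x <= s < S n.+1 x -> m = n.
Proof.
wlog: m n / (m <= n)%N.
  by move=> H Hm Hn; case/orP: (leq_total m n) => ?; [|apply/esym]; exact: H.
rewrite leq_eqVlt => /predU1P[//|mn] /andP[_ ms] /andP[ns _].
by have := lt_le_trans ms (le_trans (roof_sum_le x mn) ns); rewrite ltxx.
Qed.

Lemma xget_roof_sum x (s : R) n : S n x <= s < S n.+1 x ->
  xget 0%N (fun n => S n x <= s < S n.+1 x) = n.
Proof. by move=> h; apply: xget_unique => // m hm; exact: (roof_sum_uniq hm h). Qed.

Lemma sval_theta (q : susp tau) (t : R) n :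
  S n (sval q).1 <= (sval q).2 + t < S n.+1 (sval q).1 ->
  sval (theta T tau t q) = (iter n T (sval q).1, (sval q).2 + t - S n (sval q).1).
Proof.
move=> h; rewrite /theta (xget_roof_sum h) val_insubd ifT//.
by move: h; rewrite /susp_dom/= roof_sumSr; lra.
Qed.

Definition base (x : X) : susp tau :=
  exist _ (x, 0) (introT andP (conj (lexx 0) (roof_pos tau x))).

(* The quotient map onto the suspension space, extended to all heights: (x, s) is flowed
   from (x, 0) for s >= 0, and negative heights are truncated to 0. *)
Definition orb (p : X * R) : susp tau := theta T tau (Num.max p.2 0) (base p.1).

Lemma sval_orb x (s : R) n : 0 <= s -> S n x <= s < S n.+1 x ->
  sval (orb (x, s)) = (iter n T x, s - S n x).
Proof.
by move=> s0 h; rewrite /orb (@sval_theta _ _ n)/= add0r (max_idPl s0).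
Qed.

Lemma orb_lt0 x (s : R) : s <= 0 -> orb (x, s) = orb (x, 0).
Proof. by move=> s0; rewrite /orb/= (max_idPr s0) maxxx. Qed.

Lemma orb_T x (s : R) : tau x <= s -> orb (x, s) = orb (T x, s - tau x).
Proof.
move=> ts; have [n hn] := @roof_sum_ex (T x) (s - tau x) ltac:(lra).
apply: val_inj; rewrite /= (sval_orb _ hn); last by lra.
have t0 := roof_pos tau x.
rewrite (@sval_orb _ _ n.+1); [|lra|by rewrite 2!roof_sumS; lra].
by rewrite iterSr roof_sumS opprD addrA.
Qed.

Lemma orb_tau x : orb (x, tau x) = orb (T x, 0).
Proof. by rewrite orb_T// subrr. Qed.

Lemma sval_orb0 x (s : R) : 0 <= s < tau x -> sval (orb (x, s)) = (x, s).
Proof.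
move=> /andP[s0 st]; rewrite (@sval_orb _ _ 0)// ?roof_sum0 ?subr0//.
by rewrite roof_sumSr roof_sum0 add0r s0.
Qed.

Lemma orb_sval q : orb (sval q) = q.
Proof.
apply: val_inj; case: q => -[x s] /= /andP[/= s0 st].
by rewrite sval_orb0// s0.
Qed.

Lemma theta_sval t q : 0 <= t -> theta T tau t q = orb ((sval q).1, (sval q).2 + t).
Proof.
move=> t0; have /andP[q0 qt] := valP q.
have st0 : 0 <= (sval q).2 + t by rewrite addr_ge0.
have [n hn] := @roof_sum_ex (sval q).1 _ st0.
by apply: val_inj; rewrite /= (sval_theta hn) (sval_orb _ hn).
Qed.

Lemma orb_iter x (t : R) n : S n x <= t -> 0 <= t ->
  orb (x, t) = orb (iter n T x, t - S n x).
Proof.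
elim: n x t => [|n IH] x t; first by rewrite roof_sum0 subr0.
rewrite roof_sumS => h t0; have tx := roof_pos tau x.
have Sn := roof_sum_ge0 n (T x).
rewrite orb_T; last by lra.
by rewrite IH; [rewrite -iterSr opprD addrA|lra|lra].
Qed.

Lemma theta_orb t x (s : R) : 0 <= t -> 0 <= s -> theta T tau t (orb (x, s)) = orb (x, s + t).
Proof.
move=> t0 s0; have [n hn] := roof_sum_ex x s0.
rewrite theta_sval// (sval_orb s0 hn)/=.
rewrite [RHS](@orb_iter _ _ n); [congr orb; congr pair; lra|lra|lra].
Qed.

Lemma thetaD s t q : 0 <= s -> 0 <= t -> theta T tau s (theta T tau t q) = theta T tau (t + s) q.
Proof.
move=> s0 t0; have /andP[q0 _] := valP q.
by rewrite [in LHS](theta_sval q t0) theta_orb ?addr_ge0// theta_sval ?addr_ge0// addrA.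
Qed.

Lemma sval_orb_red x (s : R) : 0 <= s <= tau x -> sval (orb (x, s)) = susp_red T tau (x, s).
Proof.
rewrite /susp_red/=; case: eqP => [->|/eqP st] /andP[s0 sx].
  by rewrite orb_tau sval_orb0// lexx roof_pos.
by rewrite sval_orb0// s0 lt_neqAle st.
Qed.

(** On a closed fibre [orb] is exactly the identification, so the quotient topology becomes a
    condition on preimages under one map. *)
Lemma susp_openE U : susp_open T tau U <-> exists V : set (X * R), open V /\
  forall p, 0 <= p.2 <= tau p.1 -> (V p <-> U (orb p)).
Proof.
have E p : 0 <= p.2 <= tau p.1 ->
    ((exists2 q : susp tau, U q & sval q = susp_red T tau p) <-> U (orb p)).
  case: p => x s /= h; rewrite -sval_orb_red//; split=> [[q Uq /val_inj <-]//|Up].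
  by exists (orb (x, s)).
split=> -[V [oV HV]]; exists V; split => // p hp.
  by rewrite -E//; exact: HV.
by rewrite E//; exact: HV.
Qed.

Lemma susp_continuous_sval (F : X * R -> R) : continuous F ->
  (forall x, F (x, tau x) = F (T x, 0)) -> susp_continuous T tau (fun q => F (sval q)).
Proof.
move=> cF FT W oW; apply/susp_openE; exists (F @^-1` W); split.
  by move/continuousP: cF; apply.
move=> [x s] /= h; rewrite sval_orb_red// /susp_red/=.
by case: eqP => // ->; rewrite FT.
Qed.

(** Reduces continuity on the quotient to continuity on X * R. The quotient topology only controls
    [f \o orb] on the closed strip below the roof; higher points are reached by passing one roof at
    a time. *)
Lemma susp_continuous_orb (f : susp tau -> R) : susp_continuous T tau f <-> continuous (f \o orb).
Proof.
split=> [Cf|cf]; last first.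
  have := susp_continuous_sval cf; set g := (X in susp_continuous _ _ X).
  have -> : g = f by apply/funext => q; rewrite /g/= orb_sval.
  by apply => x /=; rewrite orb_tau.
(* Retracting onto the closed strip turns information relative to the strip into continuity of [Fh]
   on the whole product. *)
pose clamp (p : X * R) : X * R := (p.1, Num.min (Num.max p.2 0) (tau p.1)).
have tau1 : continuous (fun p : X * R => tau p.1) by exact: cont_comp cont_fst tauc.
have clampc : continuous clamp.
  apply: cont_pair cont_fst (cont_min _ tau1).
  exact (cont_max cont_snd (cont_cst 0)).
have cE x (s : R) : 0 <= s <= tau x -> clamp (x, s) = (x, s).
  by move=> /andP[s0 st]; rewrite /clamp/= (max_idPl s0) (min_idPl st).
have cl p : 0 <= (clamp p).2 <= tau (clamp p).1.
  by rewrite /clamp/= le_min le_max lexx orbT/= ge_min lexx orbT andbT ltW// roof_pos.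
pose Fh := f \o orb \o clamp.
have Fhc : continuous Fh.
  apply/continuousP => W oW; have /susp_openE[V [oV HV]] := Cf W oW.
  have -> : Fh @^-1` W = clamp @^-1` V.
    by apply/seteqP; split => p /=; rewrite (HV _ (cl p)).
  by move/continuousP: clampc; apply.
have Fh_le0 x (s : R) : s <= 0 -> Fh (x, s) = f (orb (x, 0)).
  by move=> s0; rewrite /Fh/= /clamp/= (max_idPr s0) (min_idPl _)// ltW// roof_pos.
pose sh (p : X * R) : X * R := (T p.1, p.2 - tau p.1).
have shc : continuous sh.
  exact: cont_pair (cont_comp cont_fst Tc) (cont_sub cont_snd tau1).
(* [G n] telescopes f o orb below the n-th roof as a sum of continuous functions, since the
   clamped function Fh takes the same value at (x, tau x) and (T x, 0). *)
pose G := fix G n (p : X * R) : R := if n is n'.+1 then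
  Fh p + (G n' (sh p) - Fh (T p.1, 0)) else Fh (p.1, 0).
have bc (h : X -> X) : continuous h -> continuous (fun p : X * R => Fh (h p.1, 0)).
  move=> hc; apply: (cont_comp _ Fhc).
  exact: cont_pair (cont_comp cont_fst hc) (cont_cst (0 : R)).
have Gc n : continuous (G n).
  elim: n => [|n IH]; first exact: (bc id (fun=> cvg_id)).
  exact: cont_add Fhc (cont_sub (cont_comp shc IH) (bc T Tc)).
have [a [b [a0 ab]]] := roof_bounds.
have GE n x (s : R) : s <= S n x -> G n (x, s) = f (orb (x, s)).
  elim: n x s => [|n IH] x s.
    by rewrite roof_sum0 => s0; rewrite /= Fh_le0// [in RHS]orb_lt0.
  rewrite roof_sumS => h /=; rewrite {1}/sh/=.
  rewrite [Fh (T x, 0)]Fh_le0//; case: (leP s (tau x)) => st.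
    have -> : G n (T x, s - tau x) = f (orb (T x, 0)).
      by rewrite IH; [rewrite orb_lt0//; lra|have := roof_sum_ge0 n (T x); lra].
    rewrite subrr addr0; case: (leP 0 s) => s0; first by rewrite /Fh/= cE// s0.
    by rewrite Fh_le0 ?[in RHS]orb_lt0// ltW.
  rewrite IH; last by lra.
  rewrite [in RHS]orb_T ?(ltW st)//.
  rewrite /Fh/= /clamp/= (max_idPl _) ?(min_idPr (ltW st)) ?orb_tau; first by lra.
  by apply: ltW; apply: lt_trans st; exact: roof_pos.
(* Roof sums grow at least like n a, so a single n puts s + 1 below the n-th roof over every base
   point, and [G n] agrees with [f \o orb] near (x, s). *)
move=> [x s]; pose n := (Num.truncn ((s + 1) / a)).+1.
have Sn y : s + 1 <= S n y.
  apply: (@le_trans _ _ (n%:R * a)); last by apply: roof_sum_lower => z; case/andP: (ab z).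
  by rewrite -ler_pdivrMr// ltW// truncnS_gt.
have near_s : \forall p \near (x, s), p.2 < s + 1.
  have snds : (fun p : X * R => p.2) @ (x, s) --> s by exact: cvg_snd.
  by apply: (cvgr_lt s snds); lra.
have e : G n (x, s) = f (orb (x, s)).
  by rewrite GE//; apply: le_trans (Sn x); lra.
rewrite /continuous_at -[X in _ --> X]/(f (orb (x, s))) -e.
apply: cvg_trans (Gc n (x, s)); apply: near_eq_cvg.
have GE' p : p.2 < s + 1 -> G n p = (f \o orb) p.
  case: p => y t ps; apply: GE.
  by apply: le_trans (Sn y); exact: ltW.
near=> p; apply: GE'; near: p; exact: near_s.
Unshelve. all: by end_near.
Qed.

End RoofSums.

(** * Cluster points, uniform continuity and cozero functions *)

Lemma compact_seq_cluster (U : topologicalType) (K : set U) (u : nat -> U) :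
  compact K -> (forall n, K (u n)) ->
  exists p, K p /\ forall A, nbhs p A -> forall N, exists n, (N <= n)%N /\ A (u n).
Proof.
move=> cK uK; have [|p [Kp cp]] := cK (u @ \oo) _; first by exists 0%N => // n _; exact: uK.
exists p; split => // A pA N.
have [] := cp (u @` [set n | (N <= n)%N]) A _ pA; last by move=> q [[n Nn <-]] Aq; exists n.
by exists N => // n /= Nn; exists n.
Qed.

Section PseudoMetric.
Context {R : realType} {M : pseudoMetricType R}.

(** Only [p] is required to lie in [K]: when two orbits are compared in [orb_unif], the second
    height may leave the compact strip. *)
Lemma compact_unif_cont (K : set M) (g : M -> R) (e : R) : compact K -> continuous g -> 0 < e ->
  exists d : R, 0 < d /\ forall p q, K p -> ball p d q -> `|g p - g q| <= e.
Proof.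
move=> cK cg e0; apply: contrapT => /forallNP H.
have {}H n : exists pq : M * M, [/\ K pq.1, ball pq.1 n.+1%:R^-1 pq.2 & e < `|g pq.1 - g pq.2|].
  apply: contrapT => /forallNP h; apply: (H n.+1%:R^-1); rewrite invr_gt0; split => // p q Kp pq.
  by rewrite leNgt; apply/negP => lt; apply: (h (p, q)).
pose u n := sval (cid (H n)).
have uP n : [/\ K (u n).1, ball (u n).1 n.+1%:R^-1 (u n).2 & e < `|g (u n).1 - g (u n).2|].
  by rewrite /u; case: cid.
have Ku n : K (u n).1 by case: (uP n).
have [p [Kp Hp]] := compact_seq_cluster (u := fun n => (u n).1) cK Ku.
have e2 : 0 < e / 2 by rewrite divr_gt0.
have /cvgrPdist_le/(_ _ e2)/nbhs_ballP[r /= r0 gr] := cg p.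
have r2 : 0 < r / 2 by rewrite divr_gt0.
have [n [Nn un]] := Hp _ (nbhsx_ballx p (r / 2) r2) (Num.truncn (r / 2)^-1).
have [_ uv] := uP n; apply/negP; rewrite -leNgt.
have b1 : ball p r (u n).1 by apply: le_ball un; lra.
have b2 : ball p r (u n).2.
  rewrite (splitr r); apply: ball_triangle un _; apply: le_ball uv.
  rewrite invf_ple ?posrE//; apply/ltW; apply: lt_le_trans (truncnS_gt _) _.
  by rewrite ler_nat.
have := gr _ b1; have := gr _ b2; rewrite /= distrC => h1 h2.
rewrite (splitr e) -(subrK (g p) (g (u n).1)) -addrA.
apply: le_trans (ler_normD _ _) _; apply: lerD; last by rewrite distrC.
by rewrite distrC.
Qed.

(* [g p] is the distance from [p] to the complement of [V], capped at [c]. *)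
Lemma open_cozero (V : set M) (c : R) : open V -> 0 < c ->
  exists g : M -> R, [/\ continuous g, forall p, 0 <= g p <= c & forall p, V p <-> 0 < g p].
Proof.
move=> oV c0; pose A p := [set r : R | r = 0 \/ 0 < r <= c /\ ball p r `<=` V].
have Ac p : ubound (A p) c by move=> r [->|[/andP[]]]//; exact: ltW.
have A0 p : A p 0 by left.
have sA p : has_sup (A p) by split; [exists 0|exists c].
have Ag p r : A p r -> r <= sup (A p) by move=> Ar; apply: sup_ubound => //; case: (sA p).
have g0 p : 0 <= sup (A p) by exact: Ag.
have lip p q e : 0 < e -> ball p e q -> sup (A p) <= sup (A q) + e.
  move=> e0 pq; apply: ge_sup; first by exists 0.
  move=> r [->|[/andP[r0 rc] rV]]; first by rewrite addr_ge0// ltW.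
  have [re|er] := leP r e; first by have := g0 q; lra.
  rewrite -lerBlDr; apply: Ag; right; split; first by lra.
  move=> z qz; apply: rV; have -> : r = e + (r - e) by lra.
  exact: ball_triangle pq qz.
exists (fun p => sup (A p)); split.
- move=> p; apply/cvgrPdist_le => e e0; near=> q.
  have pq : ball p e q by near: q; exact: nbhsx_ballx.
  have h1 := lip _ _ _ e0 pq; have h2 := lip _ _ _ e0 (ball_sym pq).
  by rewrite ler_norml; lra.
- by move=> p; rewrite g0/=; apply: ge_sup; [exists 0|exact: Ac].
- move=> p; split=> [Vp|gp].
    have /nbhs_ballP[r /= r0 rV] : nbhs p V by exact: open_nbhs_nbhs.
    apply: (@lt_le_trans _ _ (Num.min r c)); first by rewrite lt_min r0.
    apply: Ag; right; rewrite lt_min r0 c0 ge_min lexx orbT; split => // z pz.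
    by apply: rV; apply: le_ball pz; rewrite ge_min lexx.
  have [r [r0|[/andP[r0 _] rV]] gr] := sup_adherent gp (sA p).
    by move: gr; rewrite subrr r0 ltxx.
  by apply: rV; exact: ballxx.
Unshelve. all: by end_near.
Qed.
End PseudoMetric.

(** * The algebra of continuous functions on the suspension and its link to open sets *)

Section SuspContinuous.
Context {R : realType} {X : pseudoPMetricType R}.
Variables (T : X -> X) (tau : @roof R X).
Hypothesis Tc : continuous T.
Hypothesis tauc : continuous (roof_fun tau).
Hypothesis cX : compact [set: X].

Local Notation C := (susp_continuous T tau).
Local Notation orb := (orb T tau).
Let CE := susp_continuous_orb Tc tauc cX.

Lemma susp_continuous_cst (c : R) : C (fun=> c).
Proof. by apply/CE; exact: cont_cst. Qed.

Lemma susp_continuousD f g : C f -> C g -> C (fun q => f q + g q).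
Proof. by move=> /CE cf /CE cg; apply/CE; exact: cont_add cf cg. Qed.

Lemma susp_continuousM f g : C f -> C g -> C (fun q => f q * g q).
Proof. by move=> /CE cf /CE cg; apply/CE; exact: cont_mul cf cg. Qed.

Lemma susp_continuous_max f g : C f -> C g -> C (fun q => Num.max (f q) (g q)).
Proof. by move=> /CE cf /CE cg; apply/CE; exact: cont_max cf cg. Qed.

Lemma susp_continuous_min f g : C f -> C g -> C (fun q => Num.min (f q) (g q)).
Proof. by move=> /CE cf /CE cg; apply/CE; exact: cont_min cf cg. Qed.

Lemma orb_max0 x (s : R) : orb (x, Num.max s 0) = orb (x, s).
Proof.
by case: (leP 0 s) => // s0; rewrite [RHS]orb_lt0// ltW.
Qed.

Lemma susp_continuous_theta f t : 0 <= t -> C f -> C (f \o theta T tau t).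
Proof.
move=> t0 /CE cf; apply/CE.
have -> : (f \o theta T tau t) \o orb = (fun p => (f \o orb) (p.1, Num.max p.2 0 + t)).
  apply/funext => -[x s] /=.
  by rewrite -orb_max0 theta_orb// ?le_max ?lexx ?orbT.
apply: (cont_comp (f := fun p : X * R => (p.1, Num.max p.2 0 + t)) _ cf).
apply: cont_pair; first exact: cont_fst.
by apply: cont_add (cont_cst t); apply: cont_max; [exact: cont_snd|exact: cont_cst].
Qed.

(** Stands in for compactness of the suspension: the half-open fundamental domain is not closed, but
    cluster points of representatives stay in this box, and [orb] sends them back to the
    suspension. *)
Lemma susp_fundamental : exists2 K : set (X * R), compact K & forall q : susp tau, K (sval q).
Proof.
have [a [b [a0 ab]]] := roof_bounds tauc cX.
exists (setT `*` `[0, b]); first by apply: compact_setX cX _; exact: segment_compact.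
move=> q; split => //=; rewrite in_itv/=; have /andP[-> h] := valP q.
by apply: le_trans (ltW h) _; case/andP: (ab (sval q).1).
Qed.

Lemma susp_continuous_bounded f : C f -> exists M : R, forall q, `|f q| <= M.
Proof.
move=> /CE cf; have [K cK KE] := susp_fundamental.
have [M [_ fM]] := compact_norm_bound cK cf.
by exists M => q; have := fM _ (KE q); rewrite /= orb_sval.
Qed.

(** Points where the bound fails cluster at some [p] of the box; some [g N] exceeds c at [orb p],
    hence near it, and monotonicity contradicts the failure for large n. *)
Lemma susp_dini (g : nat -> susp tau -> R) : dcover C setT g ->
  forall c : R, c < 1 -> exists n, forall q, c <= g n q.
Proof.
move=> gc c c1; have [gC _ _ g1] := gc; apply: contrapT => /forallNP H.
have {}H n : exists q, g n q < c.
  apply: contrapT => /forallNP h; apply: (H n) => q.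
  by rewrite leNgt; apply/negP; exact: h.
have [K cK KE] := susp_fundamental.
pose u n := sval (cid (H n)).
have uP n : g n (u n) < c by rewrite /u; case: cid.
have [p [_ Hp]] := compact_seq_cluster cK (fun n => KE (u n)).
have [N gN] := g1 (orb p) I c c1.
have oA : open ((g N \o orb) @^-1` [set z | c < z]).
  by move/CE: (gC N) => /continuousP; apply; exact: open_gt.
have [n [Nn]] := Hp _ (open_nbhs_nbhs (conj oA gN)) N.
rewrite /= orb_sval => cn; have := lt_trans (uP n) cn.
by rewrite ltNge (dcover_homo gc _ Nn).
Qed.

Lemma susp_continuous_measurable f : C f ->
  measurable_fun [set: susp_borel T tau] (f : susp_borel T tau -> R).
Proof.
move=> Cf; apply: (measurability _ (RGenOInfty.measurableE R)) => // _ [_ [x ->] <-].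
rewrite setTI; apply: sub_sigma_algebra; apply: Cf.
by rewrite set_itvE; exact: open_gt.
Qed.

(** Ties the Borel sets to the continuous functions: through it open sets are measurable for the
    Daniell outer measure, preimages of open sets under the flow are open, and finite measures are
    determined by their integrals. A cozero function of [V] need not respect the identification; it
    is corrected with [T] at the top of each fibre and with [Ti] at the bottom. *)
Lemma susp_open_cozero (Ti : X -> X) U : continuous Ti -> cancel T Ti -> cancel Ti T ->
  susp_open T tau U -> exists2 h, C h & U = [set q | 0 < h q].
Proof.
move=> Tic TK TiK /(susp_openE T tauc cX)[V [oV HV]].
have [a [b [a0 ab]]] := roof_bounds tauc cX.
(* The cap [a] keeps g below every roof value, so that at either end of a fibre the correction
   belonging to the other end is too large to affect the minimum. *)
have [g [cg gb gV]] := open_cozero oV a0.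
have ga p : 0 <= g p by case/andP: (gb p).
have gt x p : g p <= tau x by apply: le_trans (_ : a <= _); [case/andP: (gb p)|case/andP: (ab x)].
(* At the heights 0 and tau x the two extra terms bring in the value of g at the other
   representative of the same point, so that F takes the same value at both. *)
pose F p := Num.min (g p) (Num.min (g (Ti p.1, tau (Ti p.1)) + p.2)
                                   (g (T p.1, 0) + (tau p.1 - p.2))).
have f1 := @cont_fst X R; have f2 := @cont_snd X R.
have cF : continuous F.
  have taux : continuous (fun p : X * R => tau p.1) by exact: cont_comp f1 tauc.
  have Tix : continuous (fun p : X * R => Ti p.1) by exact: cont_comp f1 Tic.
  have Tx : continuous (fun p : X * R => T p.1) by exact: cont_comp f1 Tc.
  apply: (cont_min cg); apply: cont_min.
    apply: (fun h => cont_add h f2); apply: (fun h => cont_comp h cg).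
    exact: cont_pair Tix (cont_comp Tix tauc).
  apply: (fun h => cont_add h (cont_sub taux f2)); apply: (fun h => cont_comp h cg).
  exact: cont_pair Tx (cont_cst (0 : R)).
have FE x : F (x, tau x) = F (T x, 0).
  rewrite /F/= subrr !addr0 TK [X in _ = Num.min _ X]min_l; last first.
    by rewrite subr0 (le_trans (gt (T x) _))// lerDr.
  rewrite [Num.min (_ + _) _]min_r; first by rewrite minC.
  by rewrite (le_trans (gt x _))// lerDr.
exists (fun q => F (sval q)); first exact: susp_continuous_sval.
have Vtau x : V (Ti x, tau (Ti x)) <-> V (x, 0).
  have h y (s : R) : s = 0 \/ s = tau y -> 0 <= s <= tau y.
    by move=> hs; have := roof_pos tau y; case: hs => ->; lra.
  rewrite !HV/=; [|exact: h (or_introl erefl)|exact: h (or_intror erefl)].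
  by rewrite (orb_tau T tauc cX) TiK.
apply/seteqP; split=> q /=; case: q => -[x s] /= sx; have /andP[/= s0 st] := sx;
  have -> : exist _ (x, s) sx = orb (x, s) by rewrite -[LHS](orb_sval T).
  rewrite -HV /=; last by rewrite s0 ltW.
  move=> Vxs; rewrite /F/= !lt_min (gV (x,s)).1//=; apply/andP; split; last first.
    by rewrite ltr_wpDl// subr_gt0.
  case: (ltP 0 s) => s1; first by rewrite ltr_wpDl.
  have s00 : s = 0 by apply/eqP; rewrite eq_le s0 s1.
  by rewrite s00 addr0; apply/gV/Vtau; rewrite -s00.
by rewrite /F/= lt_min => /andP[/gV Vx _]; apply/HV => //=; rewrite s0 ltW.
Qed.

End SuspContinuous.

(** * Time integrals along the flow *)

Section Primitive.
Context {R : realType}.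
Local Notation mu := (@lebesgue_measure R).

Lemma continuous_itv_integrable (h : R -> R) (a b : R) : continuous h ->
  mu.-integrable `[a, b] (EFin \o h).
Proof.
move=> ch; apply: continuous_compact_integrable; first exact: segment_compact.
exact: continuous_subspaceT.
Qed.

(* The point -1 only serves to make [F] differentiable on a neighbourhood of [0, +oo[. *)
Lemma continuous_primitive (h : R -> R) : continuous h ->
  exists F : R -> R, forall x, -1 < x -> derivable F x 1 /\ derive1 F x = h x.
Proof.
move=> ch; exists (fun x => \int[mu]_(t in `[-1, x]) h t) => x x1.
have := @continuous_FTC1_closed R h (-1) x (x + 1).
by apply; [rewrite ltrDl|exact: continuous_itv_integrable|exact: x1|exact: ch].
Qed.

(** The shifted primitive has the same difference quotients at u as [F] at s + u, so the fundamental
    theorem applies to it directly. *)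
Lemma Rintegral_shift (h F : R -> R) (s t : R) : continuous h ->
  (forall x, -1 < x -> derivable F x 1 /\ derive1 F x = h x) -> 0 <= s -> 0 <= t ->
  \int[mu]_(u in `[0, t]) h (s + u) = F (s + t) - F s.
Proof.
move=> ch FE s0; rewrite le_eqVlt => /predU1P[<-|t0].
  by rewrite set_itv1 Rintegral_set1 addr0 subrr.
pose G u := F (s + u).
have E u : (fun k : R => k^-1 *: (G (k *: 1 + u) - G u)) =
           (fun k : R => k^-1 *: (F (k *: 1 + (s + u)) - F (s + u))).
  by apply/funext => k; rewrite /G addrCA.
have dG u : -1 < u -> derivable G u 1 /\ derive1 G u = h (s + u).
  move=> u1; have [|dF <-] := FE (s + u); first lra.
  by rewrite !derive1E /derivable /derive E.
have cG u : -1 < u -> {for u, continuous G}.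
  by move=> /dG[dG' _]; apply/differentiable_continuous/derivable1_diffP.
have sc : continuous (fun u => h (s + u)).
  by apply: (fun k => cont_comp k ch); exact: cont_add (cont_cst s) (fun=> cvg_id).
rewrite /Rintegral (@continuous_FTC2 _ _ G)//=.
- by rewrite /G addr0.
- exact: continuous_subspaceT.
- split.
  + by move=> u; rewrite in_itv/= => /andP[u0 _]; apply: (dG u _).1; lra.
  + by apply: cvg_at_right_filter; apply: cG; lra.
  + by apply: cvg_at_left_filter; apply: cG; lra.
- by move=> u; rewrite in_itv/= => /andP[u0 _]; apply: (dG u _).2; lra.
Qed.
End Primitive.

Section TimeIntegral.
Context {R : realType} {X : pseudoPMetricType R}.
Variables (T : X -> X) (tau : @roof R X).
Hypothesis Tc : continuous T.
Hypothesis tauc : continuous (roof_fun tau).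
Hypothesis cX : compact [set: X].

Local Notation C := (susp_continuous T tau).
Local Notation orb := (orb T tau).
Local Notation mu := (@lebesgue_measure R).
Let CE := susp_continuous_orb Tc tauc cX.

Definition time_int (f : susp tau -> R) (q : susp tau) (t : R) : R :=
  \int[mu]_(u in `[0, t]) f (theta T tau u q).

Lemma time_avgE f q t : time_avg T tau f q t = time_int f q t / t.
Proof. by []. Qed.

Lemma orbit_continuous f x : C f -> continuous (fun s => f (orb (x, s))).
Proof.
move=> /CE cf; apply: (cont_comp (f := fun s => (x, s)) _ cf).
by apply: cont_pair; [exact: cont_cst|move=> s; exact: cvg_id].
Qed.

(** One primitive along the orbit of (x, 0) serves every starting height, so additivity in time
    becomes cancellation of differences. *)
Lemma time_int_primitive f x : C f -> exists F : R -> R, forall s t, 0 <= s -> 0 <= t ->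
  time_int f (orb (x, s)) t = F (s + t) - F s.
Proof.
move=> Cf; have [F FE] := continuous_primitive (orbit_continuous (x := x) Cf).
exists F => s t s0 t0; rewrite -(Rintegral_shift (orbit_continuous (x := x) Cf) FE s0 t0).
apply: eq_Rintegral => u /set_mem/=; rewrite in_itv/= => /andP[u0 _].
by rewrite theta_orb.
Qed.

Lemma sval_susp_ge0 (q : susp tau) : 0 <= (sval q).2.
Proof. by case/andP: (valP q). Qed.

Lemma orbit_integrable f q t : C f ->
  mu.-integrable `[0, t] (EFin \o (fun u => f (theta T tau u q))).
Proof.
move=> Cf; have sc : continuous (fun u => f (orb ((sval q).1, (sval q).2 + u))).
  apply: (cont_comp (f := fun u => (sval q).2 + u) _ (orbit_continuous (x := (sval q).1) Cf)).
  by apply: cont_add; [exact: cont_cst|move=> u; exact: cvg_id].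
apply: eq_integrable (continuous_itv_integrable 0 t sc) => //.
move=> u /set_mem/=; rewrite in_itv/= => /andP[u0 _].
by rewrite (theta_sval T tauc cX).
Qed.

Lemma time_intD s t f q : C f -> 0 <= s -> 0 <= t ->
  time_int f q (s + t) = time_int f q s + time_int f (theta T tau s q) t.
Proof.
move=> Cf s0 t0; have q0 := sval_susp_ge0 q.
have qE : q = orb ((sval q).1, (sval q).2) by rewrite -surjective_pairing orb_sval.
move: (sval q).1 (sval q).2 q0 qE => x r r0 ->.
have [F FE] := time_int_primitive x Cf.
by rewrite theta_orb// !FE ?addr_ge0// !addrA; lra.
Qed.

Lemma time_int0 f q : time_int f q 0 = 0.
Proof. by rewrite /time_int set_itv1 Rintegral_set1. Qed.

Lemma time_int_add f g q t : C f -> C g ->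
  time_int (fun y => f y + g y) q t = time_int f q t + time_int g q t.
Proof. by move=> Cf Cg; apply: RintegralD => //; exact: orbit_integrable. Qed.

Lemma time_int_scale c f q t : C f -> time_int (fun y => c * f y) q t = c * time_int f q t.
Proof. by move=> Cf; apply: RintegralZl => //; exact: orbit_integrable. Qed.

Lemma time_int_le f g q q' t : C f -> C g ->
  (forall u, 0 <= u <= t -> f (theta T tau u q) <= g (theta T tau u q')) ->
  time_int f q t <= time_int g q' t.
Proof.
move=> Cf Cg fg; apply: le_Rintegral; [by []|exact: orbit_integrable..|].
by move=> u; rewrite /= in_itv/=; exact: fg.
Qed.

Lemma time_int_cst c q t : 0 <= t -> time_int (fun=> c) q t = c * t.
Proof.
move=> t0; rewrite /time_int Rintegral_cst//= lebesgue_measure_itv/= lte_fin.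
by case: ltP => [_|t0']; rewrite ?oppr0 ?adde0//= (_ : t = 0)//; apply/eqP; rewrite eq_le t0 t0'.
Qed.

Lemma time_int_near c e f q t : C f -> 0 <= t ->
  (forall u, 0 <= u <= t -> `|f (theta T tau u q) - c| <= e) ->
  `|time_int f q t - c * t| <= e * t.
Proof.
move=> Cf t0 fc; have Cc := susp_continuous_cst Tc tauc cX.
rewrite ler_norml.
have h1 : (c - e) * t <= time_int f q t.
  rewrite -(time_int_cst _ q t0); apply: (time_int_le (q := q) (q' := q)) => // u /fc.
  by rewrite ler_norml; lra.
have h2 : time_int f q t <= (c + e) * t.
  rewrite -(time_int_cst _ q t0); apply: (time_int_le (q := q) (q' := q)) => // u /fc.
  by rewrite ler_norml; lra.
by lra.
Qed.

Lemma time_int_norm M f q t : C f -> 0 <= t -> (forall q, `|f q| <= M) ->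
  `|time_int f q t| <= M * t.
Proof.
move=> Cf t0 fM; have := @time_int_near 0 M f q t Cf t0.
by rewrite mul0r subr0; apply => u _; rewrite subr0.
Qed.

Lemma time_int_theta f q s t : C f -> 0 <= s -> 0 <= t ->
  time_int (f \o theta T tau s) q t = time_int f (theta T tau s q) t.
Proof.
move=> Cf s0 t0; apply: eq_Rintegral => u /set_mem/=; rewrite in_itv/= => /andP[u0 _].
by rewrite !(thetaD T tauc cX)// addrC.
Qed.

End TimeIntegral.

(** * Limit measures along ultrafilters *)

Lemma ultra_bounded_cvg {R : realType} {U : Type} (G : set_system U) (f : U -> R) (M : R) :
  UltraFilter G -> G [set t | `|f t| <= M] -> f @ G --> lim (f @ G).
Proof.
move=> UG GM; have PG : ProperFilter G by exact: ultra_proper.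
have [|l [_ lG]] := @segment_compact R (- M) M (f @ G) _.
  by apply: filterS GM => t ft; rewrite /= in_itv/= -ler_norml; exact: ft.
suff : f @ G --> l by move/cvgP.
move=> B lB.
have [//|nB] := in_ultra_setVsetC (f @^-1` B) UG.
by have [z []] := lG (~` B) B nB lB.
Qed.

Section LimitMeasure.
Context {R : realType} {X : pseudoPMetricType R}.
Variables (T Ti : X -> X) (tau : @roof R X).
Hypothesis Tc : continuous T.
Hypothesis Tic : continuous Ti.
Hypothesis TK : cancel T Ti.
Hypothesis TiK : cancel Ti T.
Hypothesis tauc : continuous (roof_fun tau).
Hypothesis cX : compact [set: X].

Local Notation C := (susp_continuous T tau).
Local Notation Y := (susp_borel T tau).

Lemma susp_open_thetaE t U : 0 <= t -> susp_open T tau U ->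
  susp_open T tau (theta T tau t @^-1` U).
Proof.
move=> t0 /(susp_open_cozero Tc tauc cX Tic TK TiK)[h Ch ->].
by apply: (susp_continuous_theta Tc tauc cX t0 Ch (W := [set z | 0 < z])); exact: open_gt.
Qed.

Lemma measurable_theta t : 0 <= t ->
  measurable_fun [set: Y] (theta T tau t : Y -> Y).
Proof.
move=> t0; apply: (@measurability _ _ Y Y setT _ (susp_open T tau)) => //.
move=> _ [U oU <-]; rewrite setTI; apply: sub_sigma_algebra.
exact: susp_open_thetaE.
Qed.

Lemma susp_open_setT : susp_open T tau setT.
Proof. by have := susp_continuous_cst Tc tauc cX 0 openT. Qed.

Lemma susp_open_setI : setI_closed (susp_open T tau).
Proof.
move=> A B /(susp_open_cozero Tc tauc cX Tic TK TiK)[f Cf ->].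
move=> /(susp_open_cozero Tc tauc cX Tic TK TiK)[g Cg ->].
have := susp_continuous_min Tc tauc cX Cf Cg (open_gt (y := 0)).
congr susp_open; apply/seteqP; split=> q /=; rewrite lt_min => /andP//.
Qed.

(** Open sets form a generating class stable under intersection. For U = [0 < h] the functions
    min(1, n h^+) increase to the indicator of U, so monotone convergence recovers both measures of
    U from integrals. *)
Lemma susp_measure_ext (m1 m2 : {measure set Y -> \bar R}) :
  (m1 setT < +oo)%E ->
  (forall f, C f -> (forall q, 0 <= f q) -> (\int[m1]_q (f q)%:E = \int[m2]_q (f q)%:E)%E) ->
  forall A : set Y, measurable A -> m1 A = m2 A.
Proof.
move=> m1fin H A mA.
apply: (@g_sigma_algebra_measure_unique _ R Y (susp_open T tau) _ (fun=> setT)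
  _ _ m1 m2 _ _ _ A mA) => //.
- exact: sub_sigma_algebra.
- by move=> _; exact: susp_open_setT.
- exact: bigcup_const.
- exact: susp_open_setI.
move=> U oU; have mU : measurable (U : set Y) by exact: sub_sigma_algebra.
have [h Ch UE] := susp_open_cozero Tc tauc cX Tic TK TiK oU.
pose k (n : nat) q := Num.min 1 (n%:R * Num.max (h q) 0).
have kC n : C (k n).
  apply: (susp_continuous_min Tc tauc cX); first exact: (susp_continuous_cst Tc tauc cX).
  apply: (susp_continuousM Tc tauc cX); first exact: (susp_continuous_cst Tc tauc cX).
  by apply: (susp_continuous_max Tc tauc cX) => //; exact: (susp_continuous_cst Tc tauc cX).
have k0 n q : 0 <= k n q.
  by rewrite /k le_min ler01/= mulr_ge0// le_max lexx orbT.
have kS q m n : (m <= n)%N -> k m q <= k n q.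
  move=> mn; rewrite /k le_min ge_min lexx/= ge_min; apply/orP; right.
  by apply: ler_wpM2r; rewrite ?ler_nat// le_max lexx orbT.
have klim q : (k n q)%:E @[n --> \oo] --> (\1_U q)%:E.
  apply: cvg_EFin; first by near=> n.
  rewrite indicE; have [/set_mem Uq|] := boolP (q \in U); last first.
    move=> /negP Uq; have hq : h q <= 0.
      by rewrite leNgt; apply/negP => hq; apply: Uq; rewrite mem_set// UE.
    apply: cvg_near_cst; near=> n.
    by rewrite /k /= (max_idPr hq) mulr0 (min_idPr ler01).
  have hq : 0 < h q by move: Uq; rewrite UE.
  apply: cvg_near_cst; near=> n.
  rewrite /k /= (max_idPl (ltW hq)) (min_idPl _)// -ler_pdivrMr// mul1r.
  by near: n; exact: nbhs_infty_ger.
have mono (m : {measure set Y -> \bar R}) :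
    (\int[m]_q (k n q)%:E)%E @[n --> \oo] --> m U.
  have -> : m U = (\int[m]_q limn (fun n => (k n q)%:E))%E.
    rewrite -(setIT U) -integral_indic//; apply: eq_integral => q _.
    by apply/esym/cvg_lim => //; exact: klim.
  apply: cvg_monotone_convergence => //.
  - move=> n; apply/measurable_EFinP; exact: susp_continuous_measurable.
  - by move=> n q _; rewrite lee_fin.
  - by move=> q _ m' n mn; rewrite lee_fin; exact: kS.
have h1 := mono m1; have h2 := mono m2.
have E : (fun n => \int[m1]_q (k n q)%:E)%E = (fun n => \int[m2]_q (k n q)%:E)%E.
  by apply/funext => n; exact: H.
by rewrite -(cvg_lim _ h1)// -(cvg_lim _ h2)// E.
Unshelve. all: by end_near. Qed.

Variables (p : susp tau) (G : set_system R).
Hypothesis UG : UltraFilter G.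
Hypothesis Goo : pinfty_nbhs R `<=` G.

Let PG : ProperFilter G := @ultra_proper _ _ UG.

Local Notation avg f := (time_avg T tau f p).

Let Gpos : \forall t \near G, 0 < t.
Proof. by apply: Goo; exact: nbhs_pinfty_gt. Qed.

Lemma time_avg_norm f M t : C f -> 0 < t -> (forall q, `|f q| <= M) -> `|avg f t| <= M.
Proof.
move=> Cf t0 fM; rewrite time_avgE normrM normfV (gtr0_norm t0) ler_pdivrMr//.
exact: time_int_norm (ltW t0) fM.
Qed.

Lemma ultra_time_avg_cvg f : C f -> avg f @ G --> lim (avg f @ G).
Proof.
move=> Cf; have [M fM] := susp_continuous_bounded Tc tauc cX Cf.
apply: (@ultra_bounded_cvg _ _ _ _ M) => //.
by apply: filterS Gpos => t t0; exact: time_avg_norm.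
Qed.

Let L f : R := lim (avg f @ G).
Let LP f : C f -> avg f @ G --> L f.
Proof. exact: ultra_time_avg_cvg. Qed.

Let Luniq f l : avg f @ G --> l -> L f = l.
Proof. by move=> h; exact: cvg_lim h. Qed.

Let LD f g : C f -> C g -> L (fun y => f y + g y) = L f + L g.
Proof.
move=> Cf Cg; apply: Luniq.
have -> : avg (fun y => f y + g y) = (fun t => avg f t + avg g t).
  by apply/funext => t; rewrite !time_avgE (time_int_add Tc tauc cX)// mulrDl.
by apply: cvgD; exact: LP.
Qed.

Let LZ c f : C f -> L (fun y => c * f y) = c * L f.
Proof.
move=> Cf; apply: Luniq.
have -> : avg (fun y => c * f y) = (fun t => c * avg f t).
  by apply/funext => t; rewrite !time_avgE (time_int_scale Tc tauc cX)// mulrA.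
by apply: cvgMr; exact: LP.
Qed.

Let Lle f g : C f -> C g -> (forall y, f y <= g y) -> L f <= L g.
Proof.
move=> Cf Cg fg; apply: (ler_cvg_to (LP Cf) (LP Cg)).
apply: filterS Gpos => t t0; rewrite !time_avgE ler_pM2r ?invr_gt0//.
exact: (time_int_le Tc tauc cX).
Qed.

Let L1 : L (fun=> 1) = 1.
Proof.
apply: Luniq; apply: cvg_near_cst; apply: filterS Gpos => t t0.
by rewrite time_avgE time_int_cst ?ltW// mul1r divff// gt_eqF.
Qed.

(** The time windows [0, t] and [s, s + t] differ by two windows of length s, so the two averages
    differ by at most 2 M s / t. *)
Let Ltheta f s : 0 <= s -> C f -> L (f \o theta T tau s) = L f.
Proof.
move=> s0 Cf; apply/eqP; rewrite -subr_eq0; apply/eqP.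
have Cfs := susp_continuous_theta Tc tauc cX s0 Cf.
have [M fM] := susp_continuous_bounded Tc tauc cX Cf.
have M0 : 0 <= M by exact: le_trans (fM point).
have h : avg (f \o theta T tau s) t - avg f t @[t --> G] --> L (f \o theta T tau s) - L f.
  by apply: cvgB; exact: LP.
suff h0 : avg (f \o theta T tau s) t - avg f t @[t --> G] --> (0 : R).
  exact: (cvg_unique _ h h0).
apply/cvgr0Pnorm_le => e e0.
have : \forall t \near G, 2 * M * s / e < t by apply: Goo; apply: nbhs_pinfty_gt; exact: num_real.
apply: filterS2 Gpos => t t0 te.
rewrite !time_avgE -mulrBl normrM normfV (gtr0_norm t0) ler_pdivrMr//.
have -> : time_int T (f \o theta T tau s) p t - time_int T f p t =
          time_int T f (theta T tau t p) s - time_int T f p s.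
  rewrite (time_int_theta tauc cX p Cf s0 (ltW t0)).
  have := time_intD Tc tauc cX p Cf s0 (ltW t0).
  by rewrite addrC (time_intD Tc tauc cX p Cf (ltW t0) s0); lra.
apply: (@le_trans _ _ (2 * M * s)); last by apply: ltW; rewrite [e * t]mulrC -ltr_pdivrMr.
have := time_int_norm Tc tauc cX (theta T tau t p) Cf s0 fM.
have := time_int_norm Tc tauc cX p Cf s0 fM.
rewrite !ler_norml; lra.
Qed.

(** Invariance is proved on the functional and carried over to sets by comparing nu with its image
    under [theta t]. *)
Theorem ultra_limit_measure : exists nu : probability Y R, flow_invariant T tau nu /\
  forall f, C f -> exists l : R, avg f @ G --> l /\ (\int[nu]_q (f q)%:E = l%:E)%E.
Proof.
have [nu nuE] := @daniell R (susp tau) C L (susp_continuous_cst Tc tauc cX)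
  (@susp_continuousD _ _ _ _ Tc tauc cX) (@susp_continuousM _ _ _ _ Tc tauc cX)
  (@susp_continuous_max _ _ _ _ Tc tauc cX) LD LZ Lle L1 (@susp_dini _ _ _ _ Tc tauc cX)
  (susp_open T tau) (fun U oU => susp_open_cozero Tc tauc cX Tic TK TiK oU)
  (@susp_continuous_measurable _ _ _ _) (@susp_continuous_bounded _ _ _ _ Tc tauc cX).
exists nu; split=> [t t0 A mA|f Cf]; last by exists (L f); split; [exact: LP|exact: nuE].
have mt := measurable_theta t0.
apply/esym; apply: (@susp_measure_ext nu (pushforward nu (theta T tau t : Y -> Y))) => //.
  by rewrite (le_lt_trans (probability_le1 _ _))// ltry.
move=> f Cf f0; rewrite ge0_integral_pushforward//; last first.
- by move=> q _; rewrite lee_fin.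
- by apply/measurable_EFinP; exact: susp_continuous_measurable.
by rewrite preimage_setT nuE// (nuE (f \o theta T tau t)) ?Ltheta//;
  exact: susp_continuous_theta.
Qed.

End LimitMeasure.

(** * Gluing orbit pieces by specification *)

Section Gluing.
Context {R : realType} {X : pseudoPMetricType R}.
Variable T : X -> X.
Hypothesis Tc : continuous T.
Hypothesis cX : compact [set: X].
Hypothesis specT : specification T.

Definition bsum (f : X -> R) (n : nat) (x : X) : R := \sum_(k < n) f (iter k T x).

Lemma bsum0 f x : bsum f 0 x = 0.
Proof. by rewrite /bsum big_ord0. Qed.

Lemma bsumS f n x : bsum f n.+1 x = bsum f n x + f (iter n T x).
Proof. by rewrite /bsum big_ord_recr. Qed.

Lemma bsumD f m n x : bsum f (m + n) x = bsum f m x + bsum f n (iter m T x).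
Proof.
elim: n => [|n IH]; first by rewrite addn0 bsum0 addr0.
by rewrite addnS !bsumS IH addrA -iterD addnC.
Qed.

Lemma bsum_norm f M n x : (forall y, `|f y| <= M) -> `|bsum f n x| <= n%:R * M.
Proof.
move=> fM; elim: n => [|n IH]; first by rewrite bsum0 normr0 mul0r.
rewrite bsumS -natr1 mulrDl mul1r; apply: le_trans (ler_normD _ _) _.
exact: lerD.
Qed.

Lemma bsum_near f e n x y :
  (forall k, (k < n)%N -> `|f (iter k T x) - f (iter k T y)| <= e) ->
  `|bsum f n x - bsum f n y| <= e * n%:R.
Proof.
elim: n => [|n IH] H; first by rewrite !bsum0 subrr normr0 mulr0.
rewrite !bsumS opprD addrACA -natr1 mulrDr mulr1.
apply: le_trans (ler_normD _ _) _; apply: lerD; last exact: H.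
by apply: IH => k kn; apply: H; rewrite ltnW.
Qed.

Variable phi : bool -> X -> R.
Hypothesis phic : forall i, continuous (phi i).

(** The lower length [L] is prescribed in advance, to make the gaps of specification negligible; the
    upper length [Lmax] bounds the loss inside an unfinished piece. [B] does not depend on the
    number of pieces. *)
Hypothesis blocks : forall (eps : R) (L : nat), 0 < eps ->
  exists (Lmax : nat) (xs : nat -> X) (ls : nat -> nat) (B : R),
    (forall j, (0 < ls j)%N && (L <= ls j <= Lmax)%N) /\
    forall i n, `|\sum_(j < n) bsum (phi i) (ls j) (xs j)| <=
                eps * (\sum_(j < n) ls j)%:R + B.

Lemma phi_bound : exists M : R, 0 <= M /\ forall i x, `|phi i x| <= M.
Proof.
have [M1 [p1 H1]] := compact_norm_bound cX (@phic true).
have [M2 [p2 H2]] := compact_norm_bound cX (@phic false).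
exists (M1 + M2); split; first exact: addr_ge0.
by case=> x; [have := H1 x I|have := H2 x I]; lra.
Qed.

Lemma phi_unif e : 0 < e -> exists d : R, 0 < d /\
  forall i x y, ball x d y -> `|phi i x - phi i y| <= e.
Proof.
move=> e0.
have [d1 [p1 H1]] := compact_unif_cont cX (@phic true) e0.
have [d2 [p2 H2]] := compact_unif_cont cX (@phic false) e0.
exists (Num.min d1 d2); rewrite lt_min p1 p2; split=> // -[] x y xy.
  by apply: H1 => //; apply: le_ball xy; rewrite ge_min lexx.
by apply: H2 => //; apply: le_ball xy; rewrite ge_min lexx orbT.
Qed.

(** Prolongs a given orbit piece by N further pieces, controlling the sum at every intermediate
    time. That [B] is independent of [y], [n0] and [N] is essential: the constant of a stage is
    known before the preceding stages are built. *)
Lemma stage (eta delta : R) : 0 < eta -> 0 < delta -> exists B : R, 0 <= B /\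
  forall (y : X) (n0 N : nat), exists (y' : X) (n1 : nat),
    [/\ (N <= n1)%N, (n0 <= n1)%N,
      forall p, (p <= n0)%N -> ball (iter p T y') delta (iter p T y) &
      forall i n, (n0 <= n <= n1)%N ->
        `|bsum (phi i) n y' - bsum (phi i) n0 y'| <= eta * (n - n0)%:R + B].
Proof.
move=> eta0 delta0; have eta4 : 0 < eta / 4 by rewrite divr_gt0.
have [d0 [d00 unif]] := phi_unif eta4.
have [M [M0 phiM]] := phi_bound.
have [|m specm] := @specT (Num.min delta d0); first by rewrite lt_min delta0.
(* Pieces are so long that crossing one gap, at cost m M, uses at most eta / 4 per iterate of the
   piece. *)
pose L := (Num.truncn (m%:R * M / (eta / 4))).+1.
have LP : m%:R * M <= eta / 4 * L%:R.
  by rewrite [leRHS]mulrC -ler_pdivrMr// ltW// truncnS_gt.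
have [Lmax [xs [ls [B [lsP sumP]]]]] := blocks L eta4.
have ls0 j : (0 < ls j)%N by case/andP: (lsP j).
have lsL j : (L <= ls j)%N by case/and3P: (lsP j).
have lsM j : (ls j <= Lmax)%N by case/and3P: (lsP j).
(* The three terms pay for the unfinished piece with its gap, the gap after the old piece, and the
   constant of the pieces. *)
pose B' := (Lmax + m)%:R * M + m%:R * M + `|B|.
exists B'; split; first by rewrite !addr_ge0 ?mulr_ge0.
move=> y n0 N.
pose A j := (\sum_(i < j) (ls i + m))%N.
have AS j : A j.+1 = (A j + (ls j + m))%N by rewrite /A big_ord_recr.
pose t j := (n0 + m + A j)%N.
have tS j : t j.+1 = (t j + (ls j + m))%N by rewrite /t AS addnA.
have t0 : t 0%N = (n0 + m)%N by rewrite /t /A big_ord0 addn0.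
(* Interval 0 carries the old orbit up to time [n0]; interval j + 1 carries piece j. Consecutive
   intervals are exactly m apart. *)
pose a j := if j is j'.+1 then t j' else 0%N.
pose b j := if j is j'.+1 then (t j' + ls j')%N else n0.
pose zs j := if j is j'.+1 then xs j' else y.
have [||y' Hy'] := specm N.+1 a b zs.
- by case=> [|j] _ //=; exact: leq_addr.
- by case=> [|j] _ /=; rewrite ?t0// tS addnA.
have near0 p : (p <= n0)%N -> ball (iter p T y') delta (iter p T y).
  move=> pn; have := Hy' 0%N isT p; rewrite /= subn0 addn0 => /(_ pn).
  by apply: le_ball; rewrite ge_min lexx.
have nearj j p : (j < N)%N -> (p <= ls j)%N ->
    ball (iter (p + t j) T y') d0 (iter p T (xs j)).
  move=> jN pl; have := Hy' j.+1 jN p; rewrite /= addKn => /(_ pl).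
  by apply: le_ball; rewrite ge_min lexx orbT.
have tN j : (j <= t j)%N.
  elim: j => [//|j IH]; rewrite tS; have := ls0 j; lia.
exists y', (t N); split => //; first by rewrite /t -addnA leq_addr.
move=> i n /andP[n0n nN].
pose s j := bsum (phi i) j y'.
have sdiff k l : `|s (k + l)%N - s k| <= l%:R * M.
  by rewrite /s bsumD addrC addKr; exact: bsum_norm.
pose Sl j := (\sum_(k < j) ls k)%N.
have SlS j : Sl j.+1 = (Sl j + ls j)%N by rewrite /Sl big_ord_recr.
pose Sb j := \sum_(k < j) bsum (phi i) (ls k) (xs k).
have SbS j : Sb j.+1 = Sb j + bsum (phi i) (ls j) (xs j) by rewrite /Sb big_ord_recr.
(* Of the slope eta / 2, one half comes from uniform continuity of [phi] and the other from the
   gaps. *)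
have key j : (j <= N)%N -> `|s (t j) - s (t 0%N) - Sb j| <= eta / 2 * (Sl j)%:R.
  elim: j => [|j IH] jN.
    by rewrite subrr /Sb /Sl !big_ord0 subr0 normr0 mulr0.
  have {}IH := IH (ltnW jN).
  have h1 := sdiff (t j + ls j)%N m.
  have h2 : `|bsum (phi i) (ls j) (iter (t j) T y') - bsum (phi i) (ls j) (xs j)|
      <= eta / 4 * (ls j)%:R.
    apply: bsum_near => k kl; rewrite -iterD; apply: unif.
    by apply: nearj => //; exact: ltnW.
  have h3 : s (t j + ls j)%N = s (t j) + bsum (phi i) (ls j) (iter (t j) T y').
    exact: bsumD.
  have h4 : m%:R * M <= eta / 4 * (ls j)%:R.
    by apply: le_trans LP _; rewrite ler_pM2l// ler_nat.
  rewrite tS addnA SbS SlS natrD mulrDr.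
  move: h1 h2 IH; rewrite h3 !ler_norml; lra.
have SlA j : (Sl j <= A j)%N by apply: leq_sum => k _; exact: leq_addr.
have loc j : (j <= N)%N -> (t 0%N <= n <= t j)%N ->
    exists j', (j' <= N)%N /\ (t j' <= n <= t j' + (Lmax + m))%N.
  elim: j => [|j IH] jN /andP[tn nt].
    by exists 0%N; split => //; rewrite tn/= (leq_trans nt)// leq_addr.
  have [nj|nj] := leqP n (t j); first by apply: IH; rewrite ?tn// ltnW.
  exists j; split; first exact: ltnW.
  by rewrite ltnW//=; move: nt; rewrite tS; have := lsM j; lia.
have [nt|nt] := ltnP n (t 0%N).
  have := sdiff n0 (n - n0)%N; rewrite subnKC// => /le_trans; apply.
  apply: (@le_trans _ _ (m%:R * M)).
    by apply: ler_wpM2r => //; rewrite ler_nat; move: nt; rewrite t0; lia.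
  have : 0 <= eta * (n - n0)%:R by rewrite mulr_ge0// ltW.
  have : 0 <= (Lmax + m)%:R * M by rewrite mulr_ge0.
  by have := normr_ge0 B; rewrite /B'; lra.
have [|j [jN /andP[tj jn]]] := loc N (leqnn _); first by rewrite nt.
have h1 := sdiff (t j) (n - t j)%N; rewrite subnKC// in h1.
have {}h1 : `|s n - s (t j)| <= (Lmax + m)%:R * M.
  by apply: le_trans h1 _; apply: ler_wpM2r => //; rewrite ler_nat; lia.
have h2 := sdiff n0 m; rewrite -t0 in h2.
have h3 := key j jN.
have h4 : `|Sb j| <= eta / 4 * (Sl j)%:R + B := sumP i j.
have h5 : (Sl j)%:R <= (n - n0)%:R :> R.
  by rewrite ler_nat; have := SlA j; move: tj; rewrite /t; lia.
have h6 : eta * (Sl j)%:R <= eta * (n - n0)%:R by rewrite ler_pM2l.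
have h7 : 0 <= eta * (Sl j)%:R by rewrite mulr_ge0// ltW.
have h8 := ler_norm B.
rewrite -/(s n) -/(s n0) /B'; move: h1 h2 h3 h4; rewrite !ler_norml.
lra.
Qed.

End Gluing.

(** * Passing to the limit over successive stages *)

Section StageLimit.
Context {R : realType} {X : pseudoPMetricType R}.
Variable T : X -> X.
Hypothesis Tc : continuous T.
Hypothesis cX : compact [set: X].
Variable phi : bool -> X -> R.
Hypothesis phic : forall i, continuous (phi i).

Hypothesis stages : forall eta delta : R, 0 < eta -> 0 < delta -> exists B : R, 0 <= B /\
  forall (y : X) (n0 N : nat), exists (y' : X) (n1 : nat),
    [/\ (N <= n1)%N, (n0 <= n1)%N,
      forall p, (p <= n0)%N -> ball (iter p T y') delta (iter p T y) &
      forall i n, (n0 <= n <= n1)%N ->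
        `|bsum T (phi i) n y' - bsum T (phi i) n0 y'| <= eta * (n - n0)%:R + B].

Let e (k : nat) : R := 2^-1 ^+ k.

Let e0 k : 0 < e k. Proof. by rewrite exprn_gt0// invr_gt0. Qed.
Let eS k : e k.+1 + e k.+1 = e k.
Proof. by rewrite /e exprS; lra. Qed.
Let e_le m n : (m <= n)%N -> e n <= e m.
Proof. by move=> mn; rewrite /e ler_wiXn2l// ?invr_ge0// invf_le1// ler1n. Qed.
Let e_lt (c : R) : 0 < c -> exists n, e n < c.
Proof.
move=> c0; have h : e n @[n --> \oo] --> (0 : R).
  by apply: cvg_expr; rewrite gtr0_norm ?invr_gt0// invf_lt1// ltr1n.
have [N _ HN] := cvgr_lt 0 h c c0; exists N; exact: HN N (leqnn N).
Qed.

(** In the last clause the sum includes B (k + 1), the constant of the stage that starts at n (k +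
    1): it is absorbed before that stage begins, so the average stays small throughout it. *)
Lemma stage_sequence : exists (y : nat -> X) (n : nat -> nat) (B : nat -> R),
  (forall k, 0 <= B k) /\ forall k,
  [/\ (k <= n k)%N /\ (n k <= n k.+1)%N,
      forall p, (p <= n k)%N -> ball (iter p T (y k.+1)) (e k) (iter p T (y k)),
      forall i m, (n k <= m <= n k.+1)%N ->
        `|bsum T (phi i) m (y k.+1) - bsum T (phi i) (n k) (y k.+1)| <=
          e k * (m - n k)%:R + B k &
      \sum_(j < k.+2) B j <= e k * (n k.+1)%:R].
Proof.
pose B k := sval (cid (stages (e0 k) (e0 k))).
have BP k : 0 <= B k /\ forall (y : X) (n0 N : nat), exists (yn : X * nat),
    [/\ (N <= yn.2)%N, (n0 <= yn.2)%N,
      forall p, (p <= n0)%N -> ball (iter p T yn.1) (e k) (iter p T y) &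
      forall i n, (n0 <= n <= yn.2)%N ->
        `|bsum T (phi i) n yn.1 - bsum T (phi i) n0 yn.1| <= e k * (n - n0)%:R + B k].
  rewrite /B; case: cid => /= b [b0 H]; split=> // y n0 N.
  by have [y' [n1 h]] := H y n0 N; exists (y', n1).
have B0 k : 0 <= B k by case: (BP k).
pose next k y n0 N := sval (cid ((BP k).2 y n0 N)).
(* Long enough both for n (k + 1) to exceed k and for the constants up to B (k + 1) to be
   dominated. *)
pose Nk k n0 := (n0 + k + 1 + (Num.truncn ((\sum_(j < k.+2) B j) / e k)).+1)%N.
pose st := fix st k : X * nat := if k is k'.+1 then
  next k' (st k').1 (st k').2 (Nk k' (st k').2) else (point, 0%N).
exists (fun k => (st k).1), (fun k => (st k).2), B; split => // k.
have [h1 h2 h3 h4] := svalP (cid ((BP k).2 (st k).1 (st k).2 (Nk k (st k).2))).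
split => //; last first.
  rewrite [leRHS]mulrC -ler_pdivrMr//; apply: ltW; apply: lt_le_trans (truncnS_gt _) _.
  by rewrite ler_nat; apply: leq_trans h1; rewrite leq_addl.
split => //; case: k {h1 h2 h3 h4} => [//|k].
have [h1 _ _ _] := svalP (cid ((BP k).2 (st k).1 (st k).2 (Nk k (st k).2))).
by apply: leq_trans h1; rewrite /Nk; lia.
Qed.

(** The precisions [e k] are summable, so any cluster point of the stages shadows each stage up to
    its time [n k]. The increments of the sums then transfer from the stages to this point by
    uniform continuity. *)
Theorem stage_limit : exists x : X, forall i (eps : R), 0 < eps ->
  exists N : nat, forall n, (N <= n)%N -> `|bsum T (phi i) n x| <= eps * n%:R.
Proof.
have [y [n [B [B0 H]]]] := stage_sequence.
have kn k : (k <= n k)%N by case: (H k) => -[].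
have nS k : (n k <= n k.+1)%N by case: (H k) => -[].
have nle k d : (n k <= n (k + d))%N.
  by elim: d => [|d IH]; rewrite ?addn0// addnS (leq_trans IH).
have yS k p : (p <= n k)%N -> ball (iter p T (y k.+1)) (e k) (iter p T (y k)).
  by case: (H k) => _ h _ _; exact: h.
(* The bound 2 [e k] is the full geometric tail; it reproduces itself because twice e (k + 1) equals
   e k. *)
have yd d k p : (p <= n k)%N -> ball (iter p T (y (k + d)%N)) (e k + e k) (iter p T (y k)).
  elim: d k => [|d IH] k pk; first by rewrite addn0; apply: ballxx; rewrite addr_gt0.
  apply: (ball_triangle (y := iter p T (y k.+1))); last exact: yS.
  by rewrite -(eS k) -addSnnS; apply: IH; exact: leq_trans (nS k).
have [x [_ Hx]] := compact_seq_cluster (u := y) cX (fun=> I).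
have xy k p : (p <= n k)%N -> ball (iter p T x) (e k + (e k + e k)) (iter p T (y k)).
  move=> pk; have := iter_cont Tc (n := p) (x := x).
  move=> /(_ _ (nbhsx_ballx (iter p T x) (e k) (e0 k))) /Hx/(_ k)[j [kj xj]].
  by apply: ball_triangle xj _; rewrite -(subnKC kj); exact: yd.
exists x => i eps eps0.
have eps8 : 0 < eps / 8 by rewrite divr_gt0.
have [d [d0 unif]] := phi_unif cX phic eps8.
have [K1 K1d] := e_lt (c := d / 3) ltac:(lra).
have [K2 K2e] := e_lt eps8.
pose K := maxn K1 K2.
have eKd k : (K <= k)%N -> e k + (e k + e k) <= d.
  move=> Kk; have := e_le (leq_trans (leq_maxl K1 K2) Kk); lra.
have eKe k : (K <= k)%N -> e k <= eps / 8.
  by move=> Kk; have := e_le (leq_trans (leq_maxr K1 K2) Kk); lra.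
pose s m := bsum T (phi i) m x.
have step k m : (K <= k)%N -> (n k <= m <= n k.+1)%N ->
    `|s m - s (n k)| <= eps / 4 * (m - n k)%:R + B k.
  move=> Kk km; have [_ _ /(_ i m km) h _] := H k.
  have /andP[km1 km2] := km.
  have D z : bsum T (phi i) m z = bsum T (phi i) (n k) z +
      bsum T (phi i) (m - n k) (iter (n k) T z) by rewrite -bsumD subnKC.
  move: h; rewrite /s !D !(addrC (bsum T (phi i) (n k) _)) !addrK => h.
  have h2 : `|bsum T (phi i) (m - n k) (iter (n k) T x) -
      bsum T (phi i) (m - n k) (iter (n k) T (y k.+1))| <= eps / 8 * (m - n k)%:R.
    apply: bsum_near => p pm; rewrite -!iterD; apply: unif.
    apply: le_ball (xy k.+1 _ _); first by apply: eKd; exact: leqW.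
    by lia.
  have h3 : e k * (m - n k)%:R <= eps / 8 * (m - n k)%:R.
    by apply: ler_wpM2r => //; exact: eKe.
  move: h h2; rewrite !ler_norml; lra.
(* Summing [step] over the stages after K, the linear errors telescope into eps / 4 times m, while
   the constants accumulate and are absorbed at the end. *)
have main d' m : (n (K + d') <= m <= n (K + d').+1)%N ->
    `|s m| <= `|s (n K)| + eps / 4 * m%:R + \sum_(j < (K + d').+1) B j.
  elim: d' m => [|d' IH] m.
    rewrite addn0 => km; have := step K m (leqnn _) km.
    have h : eps / 4 * (m - n K)%:R <= eps / 4 * m%:R.
      by apply: ler_wpM2l; [lra|rewrite ler_nat leq_subr].
    have hB : B K <= \sum_(j < K.+1) B j by rewrite big_ord_recr/= lerDr sumr_ge0.
    have := ler_normD (s (n K)) (s m - s (n K)); rewrite addrC subrK; lra.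
  rewrite addnS => km; have /andP[km1 _] := km.
  have Kk : (K <= (K + d').+1)%N by rewrite leqW// leq_addr.
  have h := step _ m Kk km.
  have h2 := IH (n (K + d').+1); rewrite leqnn nS in h2; have {}h2 := h2 isT.
  rewrite big_ord_recr/=.
  have := ler_normD (s (n (K + d').+1)) (s m - s (n (K + d').+1)).
  rewrite subrKC => h3.
  have h4 : eps / 4 * (m - n (K + d').+1)%:R = eps / 4 * m%:R - eps / 4 * (n (K + d').+1)%:R.
    by rewrite natrB ?mulrBr.
  move: h h2 h3; rewrite h4; lra.
pose N0 := (Num.truncn (`|s (n K)| / (eps / 4))).+1.
exists (n K.+1 + N0)%N => m Nm.
have [d' hd] : exists d', (n (K + d').+1 <= m < n (K + d').+2)%N.
  have ex : exists j, (m < n (K + j).+2)%N.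
    by exists m; apply: leq_trans (kn _); lia.
  case: (ex_minnP ex) => -[|j] mj jmin.
    by exists 0%N; rewrite mj andbT addn0 (leq_trans _ Nm)// leq_addr.
  exists j.+1; rewrite mj andbT leqNgt; apply/negP.
  by rewrite addnS => /jmin; rewrite ltnn.
have /andP[hd1 hd2] := hd.
have := main d'.+1 m; rewrite addnS hd1 (ltnW hd2) => /(_ isT).
have hB : \sum_(j < (K + d').+2) B j <= eps / 8 * m%:R.
  have [_ _ _] := H (K + d')%N; move=> /le_trans; apply.
  apply: (@le_trans _ _ (eps / 8 * (n (K + d').+1)%:R)).
    by apply: ler_wpM2r => //; apply: eKe; exact: leq_addr.
  by rewrite ler_pM2l// ler_nat.
have h1 : `|s (n K)| <= eps / 4 * m%:R.
  rewrite [leRHS]mulrC -ler_pdivrMr ?divr_gt0//; apply: ltW; apply: lt_le_trans (truncnS_gt _) _.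
  by rewrite ler_nat (leq_trans _ Nm)// leq_addl.
have h2 : 0 <= eps * m%:R by rewrite mulr_ge0// ltW.
rewrite -/(s m); lra.
Qed.

End StageLimit.

(** * Realizing an invariant measure by an orbit *)

(* Each new vector has nonpositive inner product, up to an additive constant, with the
   current sum, so that the squared norm of the sum grows at most linearly. *)
Lemma greedy_sequence {R : realType} {Q : Type} (G : bool -> Q -> R) (D : R) :
  (forall i q, `|G i q| <= D) ->
  (forall a : bool -> R, exists q, a true * G true q + a false * G false q <= 1) ->
  exists u : nat -> Q, forall i n,
    (\sum_(j < n) G i (u j)) ^+ 2 <= n%:R * (2 + 2 * D ^+ 2).
Proof.
move=> GD /choice[c cP].
pose st := fix st n : bool -> R := if n is n'.+1 then
  fun i => st n' i + G i (c (st n')) else fun=> 0.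
exists (fun n => c (st n)) => i n.
have stE k : \sum_(j < n) G k (c (st j)) = st n k.
  by elim: n => [|n IH]; rewrite ?big_ord0// big_ord_recr/= IH.
rewrite stE.
have : st n true ^+ 2 + st n false ^+ 2 <= n%:R * (2 + 2 * D ^+ 2).
  elim: {stE} n => [|n IH]; first by rewrite /= expr0n/= mul0r addr0.
  rewrite -natr1 mulrDl mul1r /=.
  have h := cP (st n); set q := c (st n) in h *.
  have sq k : G k q ^+ 2 <= D ^+ 2.
    by rewrite -real_normK ?num_real// lerXn2r ?nnegrE// (le_trans _ (GD k q)).
  have -> : (st n true + G true q) ^+ 2 + (st n false + G false q) ^+ 2 =
      (st n true ^+ 2 + st n false ^+ 2) +
      2 * (st n true * G true q + st n false * G false q) +
      (G true q ^+ 2 + G false q ^+ 2) by ring.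
  rewrite [leRHS]addrA; apply: lerD; first by apply: lerD => //; rewrite ler_piMr.
  by rewrite [2 * _]mulr_natl mulr2n lerD.
have := sqr_ge0 (st n true); have := sqr_ge0 (st n false).
by case: i; lra.
Qed.

(** Turns square-root growth into linear growth of arbitrarily small slope: d^2 n c is the product
    of e n and d^2 c / e, and such a product is at most the square of the sum. *)
Lemma norm_le_of_sqr {R : realType} (d e c z : R) (n : nat) : 0 < d -> 0 < e -> 0 <= c ->
  z ^+ 2 <= n%:R * c -> `|d * z| <= e * n%:R + d ^+ 2 * c / e.
Proof.
move=> d0 e0 c0 h.
have B0 : 0 <= d ^+ 2 * c / e by rewrite divr_ge0 ?mulr_ge0 ?sqr_ge0// ltW.
have n0 : 0 <= n%:R :> R by [].
have s0 : 0 <= e * n%:R + d ^+ 2 * c / e by rewrite addr_ge0// mulr_ge0// ltW.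
rewrite -ler_sqr ?nnegrE//.
rewrite real_normK ?num_real// exprMn.
apply: (@le_trans _ _ (d ^+ 2 * (n%:R * c))); first by rewrite ler_pM2l// exprn_gt0.
set B := d ^+ 2 * c / e in B0 *.
have -> : d ^+ 2 * (n%:R * c) = e * n%:R * B.
  by rewrite /B; field; rewrite gt_eqF.
have : 0 <= e * n%:R * B by rewrite mulr_ge0// mulr_ge0// ltW.
have := sqr_ge0 (e * n%:R); have := sqr_ge0 B.
rewrite sqrrD -mulr_natr; lra.
Qed.

(** * Integrals over fibres, and orbit sums with mean 0 *)

Section FlowBlocks.
Context {R : realType} {X : pseudoPMetricType R}.
Variables (T : X -> X) (tau : @roof R X).
Hypothesis Tc : continuous T.
Hypothesis tauc : continuous (roof_fun tau).
Hypothesis cX : compact [set: X].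

Local Notation C := (susp_continuous T tau).
Local Notation orb := (orb T tau).
Local Notation S := (roof_sum T tau).
Local Notation I := (time_int T (tau := tau)).
Local Notation th := (theta T tau).

Let CE := susp_continuous_orb Tc tauc cX.

Lemma orb_unif f (b e : R) : C f -> 0 < e -> exists d : R, 0 < d /\
  forall x y s t, 0 <= s <= b -> ball x d y -> `|s - t| < d ->
    `|f (orb (x, s)) - f (orb (y, t))| <= e.
Proof.
move=> /CE cf e0.
have cK : compact ([set: X] `*` `[0, b]) by apply: compact_setX cX _; exact: segment_compact.
have [d [d0 H]] := compact_unif_cont cK cf e0.
exists d; split => // x y s t sb xy st; apply: (H (x, s) (y, t)); last by split.
by split; rewrite //= in_itv.
Qed.

Lemma time_int_diff f e q q' t : C f -> 0 <= t ->
  (forall u, 0 <= u <= t -> `|f (th u q) - f (th u q')| <= e) ->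
  `|I f q t - I f q' t| <= e * t.
Proof.
move=> Cf t0 H.
have half p p' : (forall u, 0 <= u <= t -> f (th u p) <= f (th u p') + e) ->
    I f p t <= I f p' t + e * t.
  have Ce := susp_continuous_cst Tc tauc cX e.
  move=> h; rewrite -(time_int_cst T e p' t0) -(time_int_add Tc tauc cX)//.
  by apply: (time_int_le Tc tauc cX) => //; exact: (susp_continuousD Tc tauc cX).
have h1 : I f q t <= I f q' t + e * t.
  by apply: half => u /H; rewrite ler_norml; lra.
have h2 : I f q' t <= I f q t + e * t.
  by apply: half => u /H; rewrite ler_norml; lra.
rewrite ler_norml; lra.
Qed.

Lemma time_int_lip f M q t t' : C f -> (forall q, `|f q| <= M) -> 0 <= t -> 0 <= t' ->
  `|I f q t - I f q t'| <= M * `|t - t'|.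
Proof.
move=> Cf fM; wlog tt : t t' / t <= t'.
  move=> H t0 t0'; have [tt|tt] := leP t t'; first exact: H.
  by rewrite distrC [X in M * X]distrC; apply: H => //; exact: ltW.
move=> t0 t0'; have d0 : 0 <= t' - t by rewrite subr_ge0.
have -> : I f q t' = I f q t + I f (th t q) (t' - t).
  by rewrite -(time_intD Tc tauc cX)// addrC subrK.
rewrite opprD addrA subrr sub0r normrN distrC (ger0_norm d0).
exact: (time_int_norm Tc tauc cX).
Qed.

(** The integral over the fibre above x. Its Birkhoff sums under [T] are flow integrals up to roof
    sums, which brings the flow within reach of specification for [T]. *)
Definition roof_int (f : susp tau -> R) (x : X) : R := I f (orb (x, 0)) (tau x).

Lemma roof_int_continuous f : C f -> continuous (roof_int f).
Proof.
move=> Cf x; have [M fM] := susp_continuous_bounded Tc tauc cX Cf.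
have M0 : 0 <= M by exact: le_trans (fM point).
have [a [b [a0 ab]]] := roof_bounds tauc cX.
have tb y : 0 <= tau y <= b by rewrite ltW ?roof_pos//; case/andP: (ab y).
have b0 : 0 <= b by case/andP: (tb x) => h1; exact: le_trans.
apply/cvgrPdist_le => e e0.
have e1 : 0 < e / (2 * (b + 1)) by rewrite divr_gt0// mulr_gt0// ltr_wpDl.
have e2 : 0 < e / (2 * (M + 1)) by rewrite divr_gt0// mulr_gt0// ltr_wpDl.
have [d [d0 H]] := orb_unif b Cf e1.
have /cvgrPdist_le/(_ _ e2) near_tau := tauc (x := x).
near=> y.
have xy : ball x d y by near: y; exact: nbhsx_ballx.
have ty : `|tau x - tau y| <= e / (2 * (M + 1)) by near: y.
have h1 : `|I f (orb (x, 0)) (tau x) - I f (orb (y, 0)) (tau x)| <= e / (2 * (b + 1)) * tau x.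
  apply: time_int_diff => //; first by case/andP: (tb x).
  move=> u /andP[u0 ux]; rewrite !theta_orb// add0r; apply: H => //.
    by rewrite u0 (le_trans ux)//; case/andP: (tb x).
  by rewrite subrr normr0.
have h2 : `|I f (orb (y, 0)) (tau x) - I f (orb (y, 0)) (tau y)| <= M * `|tau x - tau y|.
  by apply: time_int_lip => //; [case/andP: (tb x)|case/andP: (tb y)].
have h3 : e / (2 * (b + 1)) * tau x <= e / 2.
  have -> : e / 2 = e / (2 * (b + 1)) * (b + 1) by field; rewrite gt_eqF// ltr_wpDl.
  by rewrite ler_pM2l//; case/andP: (tb x) => _; lra.
have h4 : M * `|tau x - tau y| <= e / 2.
  apply: (@le_trans _ _ (M * (e / (2 * (M + 1))))); first exact: ler_wpM2l.
  have -> : e / 2 = (M + 1) * (e / (2 * (M + 1))) by field; rewrite gt_eqF// ltr_wpDl.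
  by rewrite ler_pM2r//; lra.
rewrite /roof_int; move: h1 h2; rewrite !ler_norml; lra.
Unshelve. all: by end_near. Qed.

Lemma bsum_roof_int f n x : C f -> bsum T (roof_int f) n x = I f (orb (x, 0)) (S n x).
Proof.
move=> Cf; elim: n => [|n IH]; first by rewrite bsum0 roof_sum0 time_int0.
have Sn := roof_sum_ge0 T tau n x.
rewrite bsumS IH roof_sumSr (time_intD Tc tauc cX)//; last by rewrite ltW// roof_pos.
by rewrite theta_orb// add0r (orb_iter (x := x) (n := n) (t := S n x) tauc cX (lexx _) Sn) subrr.
Qed.

(** Replaces a time integral by finitely many evaluations, so that integration against nu uses only
    linearity and invariance under each [theta t], never an exchange of two integrations. *)
Lemma time_int_riemann f e (d : R) N q : C f -> 0 <= d ->
  (forall q u, 0 <= u <= d -> `|f (th u q) - f q| <= e) ->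
  `|I f q (N%:R * d) - d * \sum_(k < N) f (th (k%:R * d) q)| <= e * (N%:R * d).
Proof.
move=> Cf d0 H; elim: N => [|N IH].
  by rewrite big_ord0 !mul0r !mulr0 time_int0 subrr normr0.
have Nd : 0 <= N%:R * d by rewrite mulr_ge0.
have -> : N.+1%:R * d = N%:R * d + d by rewrite -natr1 mulrDl mul1r.
rewrite (time_intD Tc tauc cX)// big_ord_recr/= !mulrDr opprD addrACA.
apply: le_trans (ler_normD _ _) _; apply: lerD => //.
rewrite [d * f _]mulrC; apply: (time_int_near Tc tauc cX) => // u ud; exact: H.
Qed.

Variable Ti : X -> X.
Hypothesis Tic : continuous Ti.
Hypothesis TK : cancel T Ti.
Hypothesis TiK : cancel Ti T.

Variable nu : probability (susp_borel T tau) R.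
Hypothesis nu_inv : flow_invariant T tau nu.

Local Notation E f := (\int[nu]_q (f : susp_borel T tau -> R) q).

Lemma susp_continuous_integrable f : C f -> nu.-integrable setT
  (EFin \o (f : susp_borel T tau -> R)).
Proof.
move=> Cf; apply: measurable_bounded_integrable => //.
- by rewrite (le_lt_trans (probability_le1 _ _))// ltry.
- exact: susp_continuous_measurable.
- have [M fM] := susp_continuous_bounded Tc tauc cX Cf; exists M.
  split; first exact: num_real.
  by move=> x Mx y _; exact: le_trans (fM y) (ltW Mx).
Qed.

Lemma expect_theta f t : 0 <= t -> C f -> E (f \o th t) = E f.
Proof.
move=> t0 Cf; rewrite /Rintegral; congr fine.
have mt := measurable_theta Tc Tic TK TiK tauc cX t0.
transitivity (\int[pushforward nu (th t : susp_borel T tau -> susp_borel T tau)]_q (f q)%:E)%E.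
  rewrite integral_pushforward//.
  - by apply/measurable_EFinP; exact: susp_continuous_measurable.
  - exact: (susp_continuous_integrable (susp_continuous_theta Tc tauc cX t0 Cf)).
by apply: eq_measure_integral => A mA _; exact: nu_inv.
Qed.

Variable Phi : bool -> susp tau -> R.
Hypothesis PhiC : forall i, C (Phi i).
Hypothesis nuPhi : forall i, E (Phi i) = 0.

Let G (d : R) (N : nat) i q := \sum_(k < N) Phi i (th (k%:R * d) q).

Let GC d N i : 0 <= d -> C (G d N i).
Proof.
move=> d0; elim: N => [|N IH].
  have := susp_continuous_cst Tc tauc cX 0; congr (susp_continuous _ _ _).
  by apply/funext => q; rewrite /G big_ord0.
have t0 : 0 <= N%:R * d by rewrite mulr_ge0.
have := susp_continuousD Tc tauc cX IH (susp_continuous_theta Tc tauc cX t0 (PhiC i)).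
by congr (susp_continuous _ _ _); apply/funext => q; rewrite /G big_ord_recr.
Qed.

Let GE d N i : 0 <= d -> E (G d N i) = 0.
Proof.
move=> d0; elim: N => [|N IH].
  under eq_Rintegral do rewrite /G big_ord0.
  by rewrite Rintegral_cst// mul0r.
have t0 : 0 <= N%:R * d by rewrite mulr_ge0.
under eq_Rintegral do rewrite /G big_ord_recr.
rewrite RintegralD//; last 2 first.
- exact: (susp_continuous_integrable (GC N i d0)).
- exact: (susp_continuous_integrable (susp_continuous_theta Tc tauc cX t0 (PhiC i))).
by rewrite IH add0r (expect_theta t0 (PhiC i)) nuPhi.
Qed.

(** By invariance every orbit sum has integral 0, so no combination exceeds 1 everywhere. Any
    positive bound would serve; the value 1 accounts for the summand 2 in the growth constant of
    [greedy_sequence]. *)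
Lemma exists_small_combination d N (a : bool -> R) : 0 <= d ->
  exists q, a true * G d N true q + a false * G d N false q <= 1.
Proof.
move=> d0; apply: contrapT => /forallNP H.
have CG i : C (fun q => a i * G d N i q).
  by apply: (susp_continuousM Tc tauc cX); [exact: (susp_continuous_cst Tc tauc cX)|exact: GC].
have e0 : E (fun q => a true * G d N true q + a false * G d N false q) = 0.
  rewrite RintegralD//; [|exact: susp_continuous_integrable..].
  rewrite !RintegralZl//; [|exact: (susp_continuous_integrable (GC N _ d0))..].
  by rewrite !GE// !mulr0 addr0.
have : E (fun=> 1) <= E (fun q => a true * G d N true q + a false * G d N false q).
  apply: le_Rintegral => //.
  - exact: (susp_continuous_integrable (susp_continuous_cst Tc tauc cX 1)).
  - exact: (susp_continuous_integrable (susp_continuousD Tc tauc cX (CG true) (CG false))).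
  - by move=> q _; rewrite leNgt; apply/negP => h; apply: (H q); exact: ltW.
rewrite e0 Rintegral_cst// [X in _ * fine X]probability_setT/= mul1r ler10//.
Qed.

End FlowBlocks.

(** * From greedy flow segments to an orbit with prescribed averages *)

Section Realization.
Context {R : realType} {X : pseudoPMetricType R}.
Variables (T Ti : X -> X) (tau : @roof R X).
Hypothesis Tc : continuous T.
Hypothesis Tic : continuous Ti.
Hypothesis TK : cancel T Ti.
Hypothesis TiK : cancel Ti T.
Hypothesis tauc : continuous (roof_fun tau).
Hypothesis cX : compact [set: X].
Hypothesis specT : specification T.

Local Notation C := (susp_continuous T tau).
Local Notation orb := (orb T tau).
Local Notation S := (roof_sum T tau).
Local Notation I := (time_int T (tau := tau)).
Local Notation th := (theta T tau).

Lemma theta_unif f e : C f -> 0 < e -> exists d : R, 0 < d /\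
  forall q u, 0 <= u <= d -> `|f (th u q) - f q| <= e.
Proof.
move=> Cf e0; have [a [b [a0 ab]]] := roof_bounds tauc cX.
have [d [d0 H]] := orb_unif Tc tauc cX b Cf e0.
exists (d / 2); split; first by rewrite divr_gt0.
move=> q u /andP[u0 ud]; have /andP[s0 st] := valP q.
rewrite (theta_sval T tauc cX)// -[in X in _ - X](orb_sval T q) distrC.
rewrite [sval q in X in X - _]surjective_pairing; apply: H.
- by rewrite s0 (le_trans (ltW st))//; case/andP: (ab (sval q).1).
- exact: ballxx.
- by rewrite opprD addrA subrr sub0r normrN ger0_norm//; lra.
Qed.

Section Blocks.
Variable Phi : bool -> susp tau -> R.
Hypothesis PhiC : forall i, C (Phi i).
Variable nu : probability (susp_borel T tau) R.
Hypothesis nu_inv : flow_invariant T tau nu.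
Hypothesis nuPhi : forall i, \int[nu]_q (Phi i : susp_borel T tau -> R) q = 0.

Let two (P : bool -> R -> Prop) :
  (forall i, exists d : R, 0 < d /\ forall d', 0 < d' <= d -> P i d') ->
  exists d : R, 0 < d /\ forall i, P i d.
Proof.
move=> H; have [d1 [p1 H1]] := H true; have [d2 [p2 H2]] := H false.
exists (Num.min d1 d2); rewrite lt_min p1 p2; split=> // -[].
  by apply: H1; rewrite lt_min p1 p2 ge_min lexx.
by apply: H2; rewrite lt_min p1 p2 ge_min lexx orbT.
Qed.

(** Each greedy flow segment is enlarged to whole fibres, down to the base point below its start and
    up to the next roof. The slope eps splits into eps / 4 for the Riemann sums, eps / 4 for the
    added ends and eps / 2 for the greedy sums. *)
Lemma flow_blocks (eps : R) (L : nat) : 0 < eps ->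
  exists (Lmax : nat) (xs : nat -> X) (ls : nat -> nat) (B : R),
    (forall j, (0 < ls j)%N && (L <= ls j <= Lmax)%N) /\
    forall i n, `|\sum_(j < n) bsum T (roof_int T (Phi i)) (ls j) (xs j)| <=
                eps * (\sum_(j < n) ls j)%:R + B.
Proof.
move=> eps0; have [a [b [a0 ab]]] := roof_bounds tauc cX.
have ta x : a <= tau x by case/andP: (ab x).
have tb x : tau x <= b by case/andP: (ab x).
have b0 : 0 < b by apply: lt_le_trans (tb point); exact: roof_pos.
have [M [M0 PhiM]] : exists M : R, 0 <= M /\ forall i q, `|Phi i q| <= M.
  have [M1 H1] := susp_continuous_bounded Tc tauc cX (PhiC true).
  have [M2 H2] := susp_continuous_bounded Tc tauc cX (PhiC false).
  have p1 : 0 <= M1 by exact: le_trans (H1 point).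
  have p2 : 0 <= M2 by exact: le_trans (H2 point).
  exists (M1 + M2); split; first exact: addr_ge0.
  by case=> q; [have := H1 q|have := H2 q]; lra.
(* The Riemann error e1 N d amounts to at most eps / 4 per fibre, since a segment lies within [ls j]
   fibres of height at most b. *)
pose e1 := eps / (4 * b).
have e10 : 0 < e1 by rewrite divr_gt0// mulr_gt0.
have [d [d0 Hd]] : exists d : R, 0 < d /\ forall i q u, 0 <= u <= d ->
    `|Phi i (th u q) - Phi i q| <= e1.
  apply: (two (P := fun i d => forall q u, 0 <= u <= d -> `|Phi i (th u q) - Phi i q| <= e1)) => i.
  have [d [d0 H]] := theta_unif (PhiC i) e10; exists d; split=> // d' /andP[_ dd] q u /andP[u0 ud].
  by apply: H; rewrite u0 (le_trans ud).
(* [L1] is at least [L] and makes the cost 2 M b of the two ends at most (eps / 4) L1; [N] then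
   makes each segment at least as long as [L1] roofs of maximal height. *)
pose L1 := (L + (Num.truncn (2 * M * b / (eps / 4))).+1)%N.
pose N := (Num.truncn (L1%:R * b / d)).+1.
have Nd0 : 0 < N%:R * d by rewrite mulr_gt0// ltr0n.
have NL : L1%:R * b <= N%:R * d.
  by rewrite -ler_pdivrMr//; apply/ltW/truncnS_gt.
have L1M : 2 * M * b <= eps / 4 * L1%:R.
  rewrite [leRHS]mulrC -ler_pdivrMr ?divr_gt0//; apply: ltW; apply: lt_le_trans (truncnS_gt _) _.
  by rewrite ler_nat leq_addl.
pose G i q := \sum_(k < N) Phi i (th (k%:R * d) q).
have GD i q : `|G i q| <= N%:R * M.
  apply: le_trans (ler_norm_sum _ _ _) _.
  by apply: le_trans (ler_sum _ (fun k _ => PhiM i _)) _; rewrite sumr_const card_ord mulr_natl.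
have [q qP] := greedy_sequence GD (fun c => exists_small_combination Tc tauc cX Tic TK TiK
  nu_inv PhiC nuPhi N c (ltW d0)).
pose xs j := (sval (q j)).1.
have s0 j : 0 <= (sval (q j)).2 by exact: sval_susp_ge0.
have sb j : (sval (q j)).2 <= b.
  by have /andP[_ h] := valP (q j); apply: le_trans (ltW h) (tb _).
have lex j : exists n, S n (xs j) <= (sval (q j)).2 + N%:R * d < S n.+1 (xs j).
  by apply: (roof_sum_ex T tauc cX); rewrite addr_ge0// ltW.
(* The successor completes the last fibre: the piece ends at the first roof strictly above the
   height reached. *)
pose ls j := (sval (cid (lex j))).+1.
have lsP j : S (ls j).-1 (xs j) <= (sval (q j)).2 + N%:R * d < S (ls j) (xs j).
  by rewrite /ls; case: cid.
have lsL j : (L1 <= ls j)%N.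
  rewrite -(ler_nat R) -(ler_pM2r b0); apply: le_trans NL _.
  apply: le_trans (roof_sum_upper T (ls j) (xs j) tb).
  by have /andP[_ h] := lsP j; have := s0 j; lra.
have blk i j : `|bsum T (roof_int T (Phi i)) (ls j) (xs j) - d * G i (q j)| <= eps / 2 * (ls j)%:R.
  rewrite (bsum_roof_int Tc tauc cX _ _ (PhiC i)).
  have h1 := time_int_riemann Tc tauc cX N (q j) (PhiC i) (ltW d0) (Hd i).
  have qE : orb (xs j, (sval (q j)).2) = q j by rewrite -surjective_pairing orb_sval.
  have /andP[l1 l2] := lsP j.
  set s := (sval (q j)).2 in qE l1 l2.
  have z0 : 0 <= S (ls j) (xs j) - (s + N%:R * d) by lra.
  have sN0 : 0 <= s + N%:R * d by apply: addr_ge0; [exact: s0|exact: ltW].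
  have E : I (Phi i) (orb (xs j, 0)) (S (ls j) (xs j)) =
      I (Phi i) (orb (xs j, 0)) s + I (Phi i) (q j) (N%:R * d) +
      I (Phi i) (th (s + N%:R * d) (orb (xs j, 0))) (S (ls j) (xs j) - (s + N%:R * d)).
    rewrite -[in LHS](subrKC (s + N%:R * d) (S (ls j) (xs j))).
    rewrite (time_intD Tc tauc cX _ (PhiC i) sN0 z0); congr (_ + _).
    rewrite (time_intD Tc tauc cX _ (PhiC i) (s0 j) (ltW Nd0)).
    by rewrite theta_orb// add0r qE.
  have h2 := time_int_norm Tc tauc cX (orb (xs j, 0)) (PhiC i) (s0 j) (PhiM i).
  have h3 := time_int_norm Tc tauc cX (th (s + N%:R * d) (orb (xs j, 0))) (PhiC i) z0 (PhiM i).
  have h4 : M * s <= M * b by apply: ler_wpM2l => //; exact: sb.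
  have h5 : M * (S (ls j) (xs j) - (s + N%:R * d)) <= M * b.
    apply: ler_wpM2l => //; move: l1; rewrite /ls roof_sumSr/=.
    by have := tb (iter (sval (cid (lex j))) T (xs j)); lra.
  have h6 : e1 * (N%:R * d) <= eps / 4 * (ls j)%:R.
    have -> : eps / 4 = e1 * b by rewrite /e1; field; rewrite gt_eqF.
    rewrite -mulrA ler_pM2l// [b * _]mulrC.
    by apply: le_trans (roof_sum_upper T (ls j) (xs j) tb); have := s0 j; rewrite -/s; lra.
  have h7 : 2 * M * b <= eps / 4 * (ls j)%:R.
    by apply: le_trans L1M _; rewrite ler_pM2l ?divr_gt0// ler_nat.
  rewrite E; move: h1 h2 h3; rewrite -/(G i (q j)) -/s !ler_norml; lra.
pose B := d ^+ 2 * (2 + 2 * (N%:R * M) ^+ 2) / (eps / 2).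
exists (Num.truncn ((b + N%:R * d) / a)).+2, xs, ls, B; split=> [j|i n].
  rewrite ltn0Sn (leq_trans _ (lsL j)) ?leq_addr//= /ls ltnS.
  set l := sval _; have : S l (xs j) <= b + N%:R * d.
    by have /andP[h _] := lsP j; have := sb j; move: h; rewrite /ls/= -/l; lra.
  have := roof_sum_lower T l (xs j) ta => h1 h2.
  apply: ltnW; rewrite -(ltr_nat R); apply: le_lt_trans (truncnS_gt _).
  by rewrite ler_pdivlMr//; exact: le_trans h1 h2.
have h1 : `|\sum_(j < n) bsum T (roof_int T (Phi i)) (ls j) (xs j) - d * \sum_(j < n) G i (q j)|
    <= eps / 2 * (\sum_(j < n) ls j)%:R.
  rewrite mulr_sumr -sumrB natr_sum mulr_sumr.
  by apply: le_trans (ler_norm_sum _ _ _) _; apply: ler_sum => j _; exact: blk.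
have h2 := norm_le_of_sqr (e := eps / 2) d0 _ _ (qP i n).
have c0 : 0 <= 2 + 2 * (N%:R * M) ^+ 2 by rewrite addr_ge0// mulr_ge0// sqr_ge0.
have {}h2 := h2 (divr_gt0 eps0 (ltr0Sn R 1)) c0.
have h3 : n%:R <= (\sum_(j < n) ls j)%:R :> R.
  rewrite ler_nat -[leqLHS]card_ord -sum1_card; apply: leq_sum => j _.
  by rewrite /ls.
have h4 : eps / 2 * n%:R <= eps / 2 * (\sum_(j < n) ls j)%:R by rewrite ler_pM2l ?divr_gt0.
rewrite -/B in h2; move: h1 h2; rewrite !ler_norml; lra.
Qed.

(** Sums that are o(n) over n fibres are o(t), because n a <= t when n fibres have been completed;
    the unfinished fibre costs at most M b. *)
Lemma flow_average_limit : exists p : susp tau, forall i,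
  time_avg T tau (Phi i) p t @[t --> +oo] --> (0 : R).
Proof.
have phic i : continuous (roof_int T (Phi i)) by exact: (roof_int_continuous Tc tauc cX (PhiC i)).
have [x xP] := stage_limit Tc cX phic (stage cX specT phic flow_blocks).
exists (orb (x, 0)) => i; apply/cvgr0Pnorm_le => e e0.
have [a [b [a0 ab]]] := roof_bounds tauc cX.
have ta y : a <= tau y by case/andP: (ab y).
have tb y : tau y <= b by case/andP: (ab y).
have [M PhiM] := susp_continuous_bounded Tc tauc cX (PhiC i).
have M0 : 0 <= M by exact: le_trans (PhiM point).
have ea : 0 < e * a / 2 by rewrite divr_gt0// mulr_gt0.
have [N NP] := xP i _ ea.
near=> t.
have t0 : 0 < t by near: t; exact: nbhs_pinfty_gt.
have tN : N.+1%:R * b < t by near: t; apply: nbhs_pinfty_gt; exact: num_real.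
have tM : M * b / (e / 2) < t by near: t; apply: nbhs_pinfty_gt; exact: num_real.
have [n /andP[n1 n2]] := roof_sum_ex T tauc cX x (ltW t0).
have Nn : (N <= n)%N.
  have b0 : 0 < b by apply: lt_le_trans (tb point); exact: roof_pos.
  rewrite -ltnS -(ltr_nat R) -(ltr_pM2r b0).
  apply: lt_le_trans (roof_sum_upper T n.+1 x tb); apply: lt_trans n2.
  by apply: le_lt_trans tN; rewrite ler_pM2r// ler_nat.
have Sn := roof_sum_ge0 T tau n x.
have z0 : 0 <= t - S n x by lra.
rewrite time_avgE normrM normfV (gtr0_norm t0) ler_pdivrMr//.
rewrite -(subrKC (S n x) t) (time_intD Tc tauc cX _ (PhiC i) Sn z0).
rewrite -(bsum_roof_int Tc tauc cX _ _ (PhiC i)) subrKC.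
have h1 := NP n Nn.
have h2 := time_int_norm Tc tauc cX (th (S n x) (orb (x, 0))) (PhiC i) z0 PhiM.
have h3 : M * (t - S n x) <= M * b.
  by apply: ler_wpM2l => //; move: n2; rewrite roof_sumSr; have := tb (iter n T x); lra.
have h4 : M * b <= e / 2 * t by rewrite [leRHS]mulrC -ler_pdivrMr ?divr_gt0// ltW.
have h5 : e * a / 2 * n%:R <= e / 2 * t.
  have -> : e * a / 2 * n%:R = e / 2 * (n%:R * a) by ring.
  rewrite ler_pM2l ?divr_gt0//; apply: le_trans n1; exact: roof_sum_lower.
apply: le_trans (ler_normD _ _) _; lra.
Unshelve. all: by end_near. Qed.

End Blocks.

(** Subtracting the integrals reduces to mean 0. Both averages converge in the full limit, so the
    point lies in the level set of [Phi] and its upper average of [H] reaches the integral. *)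
Lemma invariant_measure_realized (Phi H : susp tau -> R) (al be : R)
  (nu : probability (susp_borel T tau) R) :
  C Phi -> C H -> flow_invariant T tau nu ->
  (\int[nu]_q (Phi q)%:E)%E = al%:E -> (\int[nu]_q (H q)%:E)%E = be%:E ->
  exists p, time_avg T tau Phi p t @[t --> +oo] --> al /\
            time_avg T tau H p t @[t --> +oo] --> be.
Proof.
move=> CPhi CH inv intPhi intH.
pose F (i : bool) q := if i then Phi q + - al else H q + - be.
have FC i : C (F i).
  by case: i; apply: (susp_continuousD Tc tauc cX) => //; exact: (susp_continuous_cst Tc tauc cX).
have F0 i : \int[nu]_q (F i : susp_borel T tau -> R) q = 0.
  have E f c : C f -> (\int[nu]_q (f q)%:E)%E = c%:E ->
      \int[nu]_q ((f : susp_borel T tau -> R) q + - c) = 0.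
    move=> Cf fc; rewrite RintegralD//; first last.
    - exact: (susp_continuous_integrable Tc tauc cX nu (susp_continuous_cst Tc tauc cX (- c))).
    - exact: (susp_continuous_integrable Tc tauc cX nu Cf).
    rewrite Rintegral_cst// [X in _ * fine X]probability_setT/= mulr1 /Rintegral fc/=.
    by rewrite subrr.
  by case: i; exact: E.
have [p pP] := flow_average_limit FC inv F0; exists p.
have conv f c : C f -> time_avg T tau (fun q => f q + - c) p t @[t --> +oo] --> (0 : R) ->
    time_avg T tau f p t @[t --> +oo] --> c.
  move=> Cf h; rewrite -[X in _ --> X]add0r.
  apply: cvg_trans (cvgD h (cvg_cst c)); apply: near_eq_cvg; near=> t.
  have t0 : 0 < t by near: t; exact: nbhs_pinfty_gt.
  suff : time_avg T tau (fun q => f q - c) p t + c = time_avg T tau f p t by [].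
  rewrite !time_avgE.
  have -> : I (fun q => f q + - c) p t = I f p t + I (fun=> - c) p t.
    exact: (time_int_add Tc tauc cX _ _ Cf (susp_continuous_cst Tc tauc cX (- c))).
  by rewrite time_int_cst ?ltW//; field; rewrite gt_eqF.
by split; apply: conv => //; [exact: (pP true)|exact: (pP false)].
Unshelve. all: by end_near. Qed.

End Realization.

(** * Upper averages compared with integrals of limit measures *)

Section Limsup.
Context {R : realType} {X : pseudoPMetricType R}.
Variables (T Ti : X -> X) (tau : @roof R X).
Hypothesis Tc : continuous T.
Hypothesis Tic : continuous Ti.
Hypothesis TK : cancel T Ti.
Hypothesis TiK : cancel Ti T.
Hypothesis tauc : continuous (roof_fun tau).
Hypothesis cX : compact [set: X].

Local Notation C := (susp_continuous T tau).

Variables Phi H : susp tau -> R.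
Hypothesis PhiC : C Phi.
Hypothesis HC : C H.

Definition limsup_avg (p : susp tau) : \bar R :=
  limf_esup (fun t => (time_avg T tau H p t)%:E) (pinfty_nbhs R).

(** Times at which the average of [H] is at least c meet every neighbourhood of infinity, so the
    filter restricted to them is proper and extends to an ultrafilter, along which averages of [Phi]
    still tend to [al]. *)
Lemma limsup_avg_attained (p : susp tau) (al c : R) : Kset T tau Phi al p ->
  (c%:E < limsup_avg p)%E -> exists nu : probability (susp_borel T tau) R,
  [/\ flow_invariant T tau nu, limit_measures T tau p nu,
      (\int[nu]_q (Phi q)%:E)%E = al%:E & (c%:E <= \int[nu]_q (H q)%:E)%E].
Proof.
move=> Kp cL; pose D := [set t : R | c <= time_avg T tau H p t].
have Dfreq V : pinfty_nbhs R V -> exists t, V t /\ D t.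
  move=> VF; apply: contrapT => /forallNP nV.
  suff : (limsup_avg p <= c%:E)%E by rewrite leNgt cL.
  apply: ge_ereal_inf; exists (ereal_sup ((fun t => (time_avg T tau H p t)%:E) @` V)).
    by exists V.
  apply: ge_ereal_sup => _ [t Vt <-]; rewrite lee_fin leNgt; apply/negP => ct.
  by apply: (nV t); split => //; exact: ltW.
have PF : ProperFilter (within D (pinfty_nbhs R)).
  by apply: Build_ProperFilter_ex => A /Dfreq[t [At Dt]]; exists t; exact: At.
have [G [UG FG]] := ultraFilterLemma PF.
have PG : ProperFilter G by exact: ultra_proper.
have Goo : pinfty_nbhs R `<=` G.
  by move=> A oA; apply: FG; apply: filterS oA => t At _.
have GD : G D by apply: FG; apply: filterS (@filterT _ (pinfty_nbhs R) _) => t _.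
have [nu [inv nuE]] := ultra_limit_measure Tc Tic TK TiK tauc cX p UG Goo.
exists nu; split => //.
- move=> k fs fsC eps eps0 M.
  have : \forall t \near G, forall i, (i < k)%N ->
      (`|(time_avg T tau (fs i) p t)%:E - \int[nu]_q (fs i q)%:E| < eps%:E)%E.
    elim: k fsC => [|k IH] fsC; first exact: nearW.
    have IHk := IH (fun i ik => fsC i (ltnW ik)).
    have [l [fl intl]] := nuE _ (fsC k (ltnSn k)).
    have /cvgrPdist_lt/(_ _ eps0) near_k := fl.
    apply: filterS2 IHk near_k => t h1 h2 i; rewrite ltnS leq_eqVlt.
    move=> /predU1P[->|]; last exact: h1.
    by rewrite intl -EFinB lte_fin distrC.
  have : \forall t \near G, M <= t by apply: Goo; apply: nbhs_pinfty_ge; exact: num_real.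
  by move=> h1 h2; have [t [Mt ht]] := filter_ex (filterI h1 h2); exists t.
- have [l [fl ->]] := nuE _ PhiC; congr EFin.
  exact: (cvg_unique _ fl (cvg_trans (cvg_app _ Goo) Kp)).
- have [l [fl ->]] := nuE _ HC; rewrite lee_fin.
  apply: (cvgr_to_ge fl); exact: GD.
Qed.

Lemma limit_measure_le_limsup (p : susp tau) (nu : probability (susp_borel T tau) R) :
  limit_measures T tau p nu -> (\int[nu]_q (H q)%:E <= limsup_avg p)%E.
Proof.
move=> Vnu; have iH := susp_continuous_integrable Tc tauc cX nu HC.
have fH := integrable_fin_num measurableT iH.
have [h hE] : exists h : R, (\int[nu]_q (H q)%:E)%E = h%:E.
  by exists (fine (\int[nu]_q (H q)%:E)%E); rewrite fineK.
apply: le_ereal_inf_tmp => _ [V [M [_ MV]] <-]; rewrite hE.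
apply/lee_subgt0Pr => e e0.
have [t [Mt /(_ 0%N isT)]] := Vnu 1%N (fun=> H) (fun _ _ => HC) e e0 (M + 1).
rewrite hE -EFinB lte_fin ltr_norml => /andP[te _].
apply: (@le_trans _ _ (time_avg T tau H p t)%:E); first by rewrite -EFinB lee_fin; lra.
by apply: ereal_sup_ubound; exists t => //; apply: MV; lra.
Qed.

Lemma lim_le_limsup_avg (p : susp tau) (be : R) :
  time_avg T tau H p t @[t --> +oo] --> be -> (be%:E <= limsup_avg p)%E.
Proof.
move=> Hbe; apply: le_ereal_inf_tmp => _ [V VF <-].
apply/lee_subgt0Pr => e e0; have /cvgrPdist_lt/(_ _ e0) near_e := Hbe.
have [t [Vt]] := filter_ex (filterI VF near_e).
rewrite ltr_norml => /andP[_ te].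
apply: (@le_trans _ _ (time_avg T tau H p t)%:E); first by rewrite -EFinB lee_fin; lra.
by apply: ereal_sup_ubound; exists t.
Qed.

Lemma limsup_avg_bounded (p : susp tau) : exists M : R, (limsup_avg p <= M%:E)%E.
Proof.
have [M HM] := susp_continuous_bounded Tc tauc cX HC; exists M.
pose V := [set t : R | 0 < t].
have VF : pinfty_nbhs R V by exact: nbhs_pinfty_gt.
apply: ge_ereal_inf; exists (ereal_sup ((fun t => (time_avg T tau H p t)%:E) @` V)).
  by exists V.
apply: ge_ereal_sup => _ [t Vt <-]; rewrite lee_fin; apply: le_trans (ler_norm _) _.
exact: (time_avg_norm Tc tauc cX).
Qed.

(** An upper average is the supremum of the reals strictly below it, the form in which
    [limsup_avg_attained] can be used. *)
Lemma limsup_avg_le (p : susp tau) (b : \bar R) :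
  (forall c : R, (c%:E < limsup_avg p)%E -> (c%:E <= b)%E) -> (limsup_avg p <= b)%E.
Proof.
move=> cb; have [M LM] := limsup_avg_bounded p.
move: LM cb; case: (limsup_avg p) => [r| |] LM cb; last by rewrite leNye.
  by apply/lee_subgt0Pr => e e0; rewrite -EFinB; apply: cb; rewrite lte_fin; lra.
by move: LM; rewrite leye_eq.
Qed.

End Limsup.

Unset Implicit Arguments.

Theorem theorem5p1 (R : realType) (X : pseudoPMetricType R) (T : X -> X)
  (tau : @roof R X) (Phi H : susp tau -> R) :
  hausdorff_space X -> compact [set: X] ->
  homeomorphism T -> specification T -> continuous (roof_fun tau) ->
  susp_continuous T tau Phi -> susp_continuous T tau H ->
  forall alpha : R, Kset T tau Phi alpha !=set0 ->
  let K := Kset T tau Phi alpha in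
  (ereal_sup [set limf_esup (fun t => (time_avg T tau H p t)%:E) (pinfty_nbhs R)
              | p in K]
   = ereal_sup [set (\int[nu]_q (H q)%:E)%E
                | nu in [set nu : probability (susp_borel T tau) R |
                          flow_invariant T tau nu /\
                          (\int[nu]_q (Phi q)%:E)%E = alpha%:E]])
  /\
  (ereal_sup [set (\int[nu]_q (H q)%:E)%E
                | nu in [set nu : probability (susp_borel T tau) R |
                          flow_invariant T tau nu /\
                          (\int[nu]_q (Phi q)%:E)%E = alpha%:E]]
   = ereal_sup [set (\int[nu]_q (H q)%:E)%E
                | nu in \bigcup_(p in K) limit_measures T tau p]).
Proof.
move=> _ cX [Tc [Ti Tic [TK TiK]]] specT tauc PhiC HC al _ K.
set S1 := ereal_sup _; set S2 := ereal_sup _; set S3 := ereal_sup _.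
(* Shared by both bounds on [S1]: the measure obtained from an orbit is at once invariant with the
   right integral and a limit point of that orbit. *)
have S1le b : (forall p c nu, K p -> flow_invariant T tau nu -> limit_measures T tau p nu ->
    (\int[nu]_q (Phi q)%:E)%E = al%:E -> (c%:E <= \int[nu]_q (H q)%:E)%E ->
    (c%:E <= b)%E) -> (S1 <= b)%E.
  move=> hb; apply: ge_ereal_sup => _ [p Kp <-].
  apply: (limsup_avg_le Tc tauc cX HC) => c cp.
  have [nu [inv lim intPhi cH]] :=
    limsup_avg_attained Tc Tic TK TiK tauc cX PhiC HC Kp cp.
  exact: hb Kp inv lim intPhi cH.
have S12 : (S1 <= S2)%E.
  apply: S1le => p c nu Kp inv _ intPhi cH; apply: le_trans cH _.
  by apply: ereal_sup_ubound; exists nu.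
have S13 : (S1 <= S3)%E.
  apply: S1le => p c nu Kp _ lim _ cH; apply: le_trans cH _.
  by apply: ereal_sup_ubound; exists nu => //; exists p.
have S31 : (S3 <= S1)%E.
  apply: ge_ereal_sup => _ [nu [p Kp lim] <-].
  apply: le_trans (limit_measure_le_limsup Tc tauc cX HC lim) _.
  by apply: ereal_sup_ubound; exists p.
have S21 : (S2 <= S1)%E.
  apply: ge_ereal_sup => _ [nu [inv intPhi] <-].
  have fH := integrable_fin_num measurableT (susp_continuous_integrable Tc tauc cX nu HC).
  have [p [Kp Hp]] := invariant_measure_realized Tc Tic TK TiK tauc cX specT PhiC HC inv
    intPhi (esym (fineK fH)).
  rewrite -(fineK fH); apply: le_trans (lim_le_limsup_avg Hp) _.
  by apply: ereal_sup_ubound; exists p.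
have E12 : S1 = S2 by apply/eqP; rewrite eq_le S12 S21.
by split => //; rewrite -E12; apply/eqP; rewrite eq_le S13 S31.
Qed.
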